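(* Let $n\ge2$ and $d\ge1$. There is a constant $C_{n,d}>1$, depending only on $n$ and $d$, such that for every $\tau>1$ and every harmonic measure $\omega=\omega_h$ associated to a harmonic polynomial $h:\mathbb{R}^n\to\mathbb{R}$ of degree $d$ with $h(0)=0$, $$\frac{\tau^{n+d-2}}{C_{n,d}}\le\liminf_{r\to\infty}\frac{\omega(B_{\tau r})}{\omega(B_r)}\le\limsup_{r\to\infty}\frac{\omega(B_{\tau r})}{\omega(B_r)}\le C_{n,d}\,\tau^{n+d-2}.$$
   Context: $B_r$ is the closed ball of radius $r$ centered at the origin. For a non-zero harmonic polynomial $h:\mathbb{R}^n\to\mathbb{R}$ with $h(0)=0$ let $h^\pm=\max(\pm h,0)$. The harmonic measure $\omega_h$ associated to $h$ is the Radon measure supported on $\{h=0\}$ determined by $\int\varphi\,d\omega_h=\int_{\{h^+>0\}}h^+\Delta\varphi=\int_{\{h^->0\}}h^-\Delta\varphi$ for all $\varphi\in C_c^\infty(\mathbb{R}^n)$. *)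

(* Defs.v *)
From HB Require Import structures.
From mathcomp Require Import all_boot all_order all_algebra.
From mathcomp Require Import all_classical all_reals all_analysis.
From mathcomp Require Import measurable_realfun.
From mathcomp Require mpoly.
Import Order.TTheory GRing.Theory Num.Theory.
Import numFieldNormedType.Exports.

Set Implicit Arguments.
Unset Strict Implicit.
Unset Printing Implicit Defensive.

Local Open Scope classical_set_scope.
Local Open Scope ring_scope.

(* Matrices carry the Borel sigma-algebra of their topology. *)
HB.instance Definition _ (R : realType) (m n : nat) :=
  Measurable.copy 'M[R]_(m, n) (g_sigma_algebraType (@open 'M[R]_(m, n))).

Section lebesgue_rV.
Context {R : realType}.

Definition rat_ball n (c : 'rV[rat]_n * rat) : set 'rV[R]_n :=
  ball (\row_j ratr (c.1 0 j) : 'rV[R]_n) (ratr c.2).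

Lemma open_rV_bigcup n (U : set 'rV[R]_n) : open U ->
  U = \bigcup_(c in [set: 'rV[rat]_n * rat])
        (rat_ball c `&` [set _ | rat_ball c `<=` U]).
Proof.
move=> oU; apply/seteqP; split=> [x Ux|x [c _ [] xc /(_ x xc)]//].
have /nbhs_ballP[e /= e0 xeU] : nbhs x U by exact: open_nbhs_nbhs.
have [r] := rat_in_itvoo (divr_gt0 e0 (ltr0n R 2)).
rewrite in_itv /= => /andP[r0 re].
have /choice[q xq] j : exists q : rat, `|x 0 j - ratr q| < ratr r.
  have [|q] := @rat_in_itvoo R (x 0 j - ratr r) (x 0 j + ratr r).
    by rewrite ltrD2l; exact: gtrN.
  by rewrite in_itv /= => xq; exists q; rewrite distrC ltr_distl.
have xB : rat_ball (\row_j q j, r) x.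
  split=> // i j; rewrite ord1 !mxE /ball /= distrC; exact: xq.
exists (\row_j q j, r) => //=; split=> // y qy.
apply/xeU/(@le_ball _ _ _ (ratr r + ratr r)).
  by rewrite ltW// (splitr e) ltrD.
exact: ball_triangle (ball_sym xB) qy.
Qed.

Lemma measurable_fun_rV d (T : measurableType d) n (f : T -> 'rV[R]_n) :
  (forall j, measurable_fun setT (fun t => f t 0 j)) -> measurable_fun setT f.
Proof.
move=> mf; apply: (measurability (@open 'rV[R]_n)) => // _ [U oU <-].
rewrite setTI (open_rV_bigcup oU) preimage_bigcup.
apply: countable_bigcupT_measurable => [|[c r] /=]; first exact: countableP.
rewrite preimage_setI.
have [sub|nsub] := pselect (rat_ball (c, r) `<=` U);
  last by rewrite [X in _ `&` X](_ : _ = set0) ?setI0//; apply/seteqP; split.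
rewrite [X in _ `&` X](_ : _ = setT) ?setIT; last by apply/seteqP; split.
have [r0|r0] := ltP 0 (ratr r : R); last first.
  rewrite (_ : _ @^-1` _ = set0)//; apply/seteqP; split=> // t [].
  by rewrite ltNge r0.
rewrite (_ : _ @^-1` _ =
  \bigcap_(j in [set: 'I_n])
    ((fun t => f t 0 j) @^-1` ball (ratr (c 0 j) : R) (ratr r))).
  apply: fin_bigcap_measurable => // j _.
  by rewrite -[X in measurable X]setTI; apply: mf => //; exact: measurable_ball.
apply/seteqP; split=> [t [_ tb] j _|t tb]; first by have := tb 0 j; rewrite mxE.
by split=> // i j; rewrite ord1 mxE; exact: tb.
Qed.

Lemma continuous_measurable_rV n (f : 'rV[R]_n -> R) :
  continuous f -> measurable_fun setT f.
Proof.
move=> /continuousP cf; apply: (measurability _ (RGenOpens.measurableE R)).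
move=> _ [_ [a [b ->] <-]]; rewrite setTI; apply: sub_sigma_algebra.
exact/cf/interval_open.
Qed.

Lemma measurable_coord n (j : 'I_n) :
  measurable_fun setT (fun x : 'rV[R]_n => x 0 j).
Proof. by apply: continuous_measurable_rV; exact: coord_continuous. Qed.

Definition cons_rV n (p : R * 'rV[R]_n) : 'rV[R]_n.+1 :=
  row_mx p.1%:M p.2.

Definition uncons_rV n (x : 'rV[R]_n.+1) : R * 'rV[R]_n :=
  (x 0 0, \row_j x 0 (lift 0 j)).

Lemma cons_rV0 n p : @cons_rV n p 0 0 = p.1.
Proof. by rewrite mxE; case: splitP => // j _; rewrite ord1 mxE eqxx. Qed.

Lemma cons_rV_lift n p j : @cons_rV n p 0 (lift 0 j) = p.2 0 j.
Proof.
rewrite mxE; case: splitP => [k|k [jk]]; first by rewrite ord1.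
by congr (p.2 _ _); apply: val_inj.
Qed.

Lemma cons_rVK n : cancel (@cons_rV n) (@uncons_rV n).
Proof.
move=> [a x]; congr pair; first exact: cons_rV0.
by apply/rowP => j; rewrite mxE cons_rV_lift.
Qed.

Lemma measurable_cons_rV n : measurable_fun setT (@cons_rV n).
Proof.
apply: measurable_fun_rV => j; have [i|] := unliftP 0 j => ->.
- under eq_fun do rewrite cons_rV_lift.
  apply: (measurableT_comp (f := fun x : 'rV[R]_n => x 0 i));
    last exact: measurable_snd.
  exact: measurable_coord.
- by under eq_fun do rewrite cons_rV0; exact: measurable_fst.
Qed.

Lemma measurable_uncons_rV n : measurable_fun setT (@uncons_rV n).
Proof.
apply: measurable_fun_pair.
  exact: measurable_coord.
apply: measurable_fun_rV => j; under eq_fun do rewrite mxE.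
exact: measurable_coord.
Qed.

Section step.
Context n (mu : {sigma_finite_measure set 'rV[R]_n -> \bar R}).

Definition lebesgue_rV_step : set 'rV[R]_n.+1 -> \bar R :=
  pushforward (@lebesgue_measure R \x mu)%E (@cons_rV n).

Let step0 : lebesgue_rV_step set0 = 0%E.
Proof. by rewrite /lebesgue_rV_step /pushforward preimage_set0 measure0. Qed.

Let step_ge0 A : (0 <= lebesgue_rV_step A)%E.
Proof. by rewrite /lebesgue_rV_step /pushforward measure_ge0. Qed.

Let step_sigma_additive : semi_sigma_additive lebesgue_rV_step.
Proof.
have mcons A : measurable A -> measurable (@cons_rV n @^-1` A).
  by move=> mA; rewrite -[X in measurable X]setTI; exact: measurable_cons_rV.
move=> F mF tF mUF; rewrite /lebesgue_rV_step /pushforward preimage_bigcup.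
apply: measure_semi_sigma_additive => [i||]; first exact: mcons.
- apply/trivIsetP => i j _ _ ij; rewrite -preimage_setI.
  by move/trivIsetP : tF => /(_ _ _ _ _ ij) ->//; rewrite preimage_set0.
- by rewrite -preimage_bigcup; exact: mcons.
Qed.

HB.instance Definition _ := isMeasure.Build _ _ _ lebesgue_rV_step
  step0 step_ge0 step_sigma_additive.

Let step_sigma_finite : sigma_finite setT lebesgue_rV_step.
Proof.
have /sigma_finiteP[F [UF ndF Foo]] := sigma_finiteT (@lebesgue_measure R).
have /sigma_finiteP[G [UG ndG Goo]] := sigma_finiteT mu.
exists (fun k => @uncons_rV n @^-1` (F k `*` G k)).
  apply/seteqP; split=> // x _; have [i _ Fi] : (\bigcup_k F k) (x 0 0).
    by rewrite -UF.
  have [j _ Gj] : (\bigcup_k G k) (uncons_rV x).2 by rewrite -UG.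
  exists (maxn i j) => //; split=> /=.
  - by move: Fi; exact/subsetPset/ndF/leq_maxl.
  - by move: Gj; exact/subsetPset/ndG/leq_maxr.
move=> k; have [mF Fkoo] := Foo k; have [mG Gkoo] := Goo k; split.
  rewrite -[X in measurable X]setTI; apply: measurable_uncons_rV => //.
  exact: measurableX.
rewrite /lebesgue_rV_step /pushforward -comp_preimage.
rewrite (_ : _ \o _ = id) ?preimage_id; last exact/funext/cons_rVK.
by rewrite product_measure1E// lte_mul_pinfty// ge0_fin_numE.
Qed.

HB.instance Definition _ := Measure_isSigmaFinite.Build _ _ _ lebesgue_rV_step
  step_sigma_finite.

End step.

Fixpoint lebesgue_rV n : {sigma_finite_measure set 'rV[R]_n -> \bar R} :=
  match n with
  | 0 => \d_(0 : 'rV[R]_0)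
  | m.+1 => lebesgue_rV_step (lebesgue_rV m)
  end.

Lemma lebesgue_rV_box n (A : 'I_n -> set R) : (forall i, measurable (A i)) ->
  lebesgue_rV n [set x | forall i, A i (x 0 i)] =
  (\prod_(i < n) lebesgue_measure (A i : set (measurableTypeR R)))%E.
Proof.
elim: n A => [|n IHn] A mA.
  by rewrite big_ord0 /= diracE mem_set//= => -[].
have mbox : measurable [set x : 'rV[R]_n | forall j, A (lift 0 j) (x 0 j)].
  rewrite (_ : [set _ | _] = \bigcap_(j in [set: 'I_n])
      ((fun x : 'rV[R]_n => x 0 j) @^-1` A (lift 0 j))).
    apply: fin_bigcap_measurable => // j _.
    by rewrite -[X in measurable X]setTI; exact: measurable_coord.
  by apply/seteqP; split=> [x Ax j _|x Ax j]; exact: Ax.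
rewrite big_ord_recl -(IHn (fun j => A (lift 0 j)))//.
rewrite /= -product_measure1E//; last exact: (mA ord0).
rewrite /lebesgue_rV_step /pushforward.
congr (product_measure1 _ _ _).
apply/seteqP; split=> [p Ap|p [Ap0 Ap] i].
  split=> [|j]; first by rewrite -cons_rV0; exact: Ap.
  by rewrite -cons_rV_lift; exact: Ap.
by have [j|] := unliftP 0 i => ->; rewrite ?cons_rV_lift ?cons_rV0.
Qed.

End lebesgue_rV.
Arguments lebesgue_rV {R} n.

Section calculus.
Context {R : realType} {n : nat}.
Implicit Types f phi : 'rV[R]_n -> R.

(* The norm of 'rV[R]_n in the library is the sup norm. *)
Definition euclidean_cball (r : R) : set 'rV[R]_n :=
  [set x | Num.sqrt (\sum_(i < n) x 0 i ^+ 2) <= r].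

Definition partial (i : 'I_n) f : 'rV[R]_n -> R :=
  fun x => 'D_(delta_mx 0 i) f x.

Definition partials (s : seq 'I_n) f : 'rV[R]_n -> R := foldr partial f s.

Definition of_class_C (k : nat) f : Prop :=
  (forall s, (size s <= k)%N -> continuous (partials s f)) /\
  (forall s i x, (size s < k)%N -> derivable (partials s f) x (delta_mx 0 i)).

Definition smooth f : Prop := forall k, of_class_C k f.

Definition laplacian f : 'rV[R]_n -> R :=
  fun x => \sum_(i < n) partial i (partial i f) x.

Definition harmonic_function f : Prop :=
  of_class_C 2 f /\ forall x, laplacian f x = 0.

Definition test_function phi : Prop :=
  smooth phi /\ compact (closure [set x | phi x != 0]).

(* No regularity clause: every Borel measure on R^n that is finite on compact
   sets is regular. *)
Definition radon (mu : {measure set 'rV[R]_n -> \bar R}) : Prop :=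
  forall K : set 'rV[R]_n, compact K -> (mu K < +oo)%E.

Definition harmonic_measure (h : 'rV[R]_n -> R)
    (omega : {measure set 'rV[R]_n -> \bar R}) : Prop :=
  [/\ radon omega,
      omega (~` [set x | h x = 0]) = 0%E
    & forall phi, test_function phi ->
        (\int[omega]_x (phi x)%:E =
           \int[lebesgue_rV n]_(x in [set x | (0 < h^\+ x)%R])
             (h^\+ x * laplacian phi x)%:E)%E /\
        (\int[omega]_x (phi x)%:E =
           \int[lebesgue_rV n]_(x in [set x | (0 < h^\- x)%R])
             (h^\- x * laplacian phi x)%:E)%E].

End calculus.

Section polynomial.
Import -(notations) mpoly.
Context {R : realType} {n : nat}.

(* [msize p] is one plus the total degree of [p]. *)
Definition polynomial_of_degree (d : nat) (h : 'rV[R]_n -> R) : Prop :=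
  exists2 p : mpoly n R, msize p = d.+1 &
    forall x, h x = meval (fun i => x 0 i) p.

End polynomial.

(* Main.v *)
Require Import Defs.
From mathcomp Require Import all_boot all_order all_algebra.
From mathcomp Require Import all_classical all_reals all_analysis.
From mathcomp Require Import measurable_realfun zify ring lra.
From mathcomp Require mpoly.
Import Order.TTheory GRing.Theory Num.Theory.
Import numFieldNormedType.Exports.

(* Testing omega against a radial cutoff phi_r that is positive on B_r and
   supported in B_{2r} gives  c omega(B_r) <= q(r) <= omega(B_{2r}) with
   q(r) = \int phi_r d omega = \int h^+ Delta phi_r = \int h^- Delta phi_r.
   Let d be the degree of h and H its homogeneous part of degree d. Replacing
   h^+ by H^+ costs O(r^{n+d-3}), and by scaling
   \int H^+ Delta phi_r = r^{n+d-2} \int H^+ Delta phi_1, so q(r) is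
   equivalent to r^{n+d-2} P with P = \int H^+ Delta phi_1.
   Euler's identity for H^+, in integrated form, turns P into
   2 d \int H^+ w for a weight w > 0 on B_2. The same computation with h^-
   gives P = 2 d \int H^- w, hence P = d \int |H| w > 0. *)

Local Open Scope classical_set_scope.
Local Open Scope ring_scope.

Set Implicit Arguments.
Unset Strict Implicit.
Unset Printing Implicit Defensive.

(** The data that depend on h are [P] and the threshold beyond which the asymptotics are effective.
    The first cancels in a ratio of masses and limits at infinity do not see the second, so the
    constant [2 ^+ e.+1 / c] is uniform in h; here e = n + d - 2, and c = exp(-1/3) is the least
    value of the cutoff on B_r. The obstacle is the sign of [P]. Delta phi_1 takes both signs, and
    H^+ need not be differentiable across the zero set of H, so Euler's pointwise identity cannot
    simply be integrated by parts. The derivative is put on the radial weight instead: for F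
    homogeneous of degree d, the integral of F(x) u(t^2 |x|^2) is a multiple of t^-(n+d), and its
    derivative at t = 1 involves no derivative of F. Write phi_1 = g(4 - |x|^2) with g(s) =
    exp(-1/s) for s > 0. Then Delta phi_1 = 4 |x|^2 g'' - 2 n g'. Under the integral against F the
    identity trades 4 |x|^2 g'' for 2 (n + d) g', which leaves 2 d g'. Hence w = g', evaluated at 4
    - |x|^2. *)

Section chain_rule.
Context {R : realType} {V : normedModType R}.

Lemma derive_along_line (f : V -> R) x v :
  'D_v f x = 'D_1 (fun h : R => f (h *: v + x)) 0.
Proof.
rewrite /derive; set g1 := fun h => h^-1 *: _; set g2 := fun h => h^-1 *: _.
suff -> : g1 = g2 by [].
by apply/funext => h; rewrite /g1 /g2/= addr0 scale0r add0r [_%:A]mulr1.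
Qed.

(** Restricting [f] to the line [h *: v + x] reduces this to the chain rule in one variable, so
    derivability in the single direction [v] suffices. *)
Lemma is_derive_comp (f : V -> R) (g : R -> R) x v df dg :
  is_derive x v f df -> is_derive (f x) 1 g dg ->
  is_derive x v (g \o f) (dg * df).
Proof.
move=> [fd <-] [gd <-]; have /derivable1P fd1 := fd.
have fx : f x = f ((0 : R) *: v + x) by rewrite scale0r add0r.
rewrite fx in gd *.
split.
  apply/derivable1P/derivable1_diffP.
  apply: (@differentiable_comp _ _ _ _ (fun h : R => f (h *: v + x)) g);
    exact/derivable1_diffP.
rewrite derive_along_line -derive1E (derive1_comp fd1 gd) !derive1E.
by rewrite -derive_along_line.
Qed.

End chain_rule.

(** * The flat function exp(-1/t) and its derivatives *)

Section flat_exp_theory.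
Context {R : realType}.

(* The factor t^-k makes the family closed under differentiation. *)
Definition flat_exp (k : nat) (t : R) : R :=
  if 0 < t then t^-1 ^+ k * expR (- t^-1) else 0.

Lemma flat_exp_le0 k t : t <= 0 -> flat_exp k t = 0.
Proof. by rewrite /flat_exp; case: ltP. Qed.

Lemma flat_exp_gt0 k t : 0 < t -> 0 < flat_exp k t.
Proof.
by move=> t0; rewrite /flat_exp t0 mulr_gt0 ?expR_gt0// exprn_gt0 ?invr_gt0.
Qed.

Lemma flat_exp_ge0 k t : 0 <= flat_exp k t.
Proof. by case: (ltP 0 t) => [/(flat_exp_gt0 k)/ltW//|/flat_exp_le0 ->]. Qed.

(** For t > 0 and y = 1/t, the exponential series gives exp(y) >= 1 + y^(k+2) / (k+2)!, which
    absorbs t^-k and leaves a factor t^2. The quadratic bound forces derivative 0 at the origin and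
    later supplies the uniform bound [flat_exp_ub]. *)
Lemma flat_exp_le_sqr k t : flat_exp k t <= (k.+2)`!%:R * t ^+ 2.
Proof.
rewrite /flat_exp; case: ltP => [t0|_]; last by rewrite mulr_ge0 ?ler0n ?sqr_ge0.
have y0 : 0 < t^-1 by rewrite invr_gt0.
rewrite expRN ler_pdivrMr ?expR_gt0//.
apply: (@le_trans _ _ ((k.+2)`!%:R * t ^+ 2 *
    (1 + t^-1 ^+ k.+2 / (k.+2)`!%:R))); last first.
  apply: ler_wpM2l; first by apply: mulr_ge0; rewrite ?ler0n ?sqr_ge0.
  by apply: expR_ge1Dxn; exact: ltW.
rewrite mulrDr mulr1.
rewrite [X in _ + X](_ : _ = t^-1 ^+ k); last first.
  have f0 : (k.+2)`!%:R != 0 :> R by rewrite pnatr_eq0 -lt0n fact_gt0.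
  rewrite -addn2 exprD; set F := (_`!%:R); field.
  by rewrite /F addn2 f0 gt_eqF.
by rewrite lerDr mulr_ge0 ?ler0n ?sqr_ge0.
Qed.

Lemma is_derive_flat_exp k (t : R) :
  is_derive t 1 (flat_exp k) (flat_exp k.+2 t - k%:R * flat_exp k.+1 t).
Proof.
have [t0|t0|->] := ltgtP t 0.
- rewrite !flat_exp_le0 ?ltW// mulr0 subr0.
  apply: (@near_eq_is_derive _ _ _ (cst 0)).
  near=> s; rewrite flat_exp_le0//; apply: ltW; near: s; exact: lt_nbhsl.
- apply: (@near_eq_is_derive R R R (fun t : R => t^-1 ^+ k * expR (- t^-1))).
    near=> s; rewrite /flat_exp ifT//; near: s; exact: lt_nbhsr.
  have tn0 : t != 0 by rewrite gt_eqF.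
  have dV : is_derive t 1 (@GRing.inv R) (- t^-2).
    apply: DeriveDef; first exact: (@derivableV _ _ id).
    by rewrite (@deriveV _ _ id)// derive_id [_ *: _]mulr1.
  have dX : is_derive t 1 (fun t : R => t^-1 ^+ k) (k%:R * t^-1 ^+ k.-1 * - t^-2).
    by have := is_deriveX k dV; rewrite exprfctE.
  have dE : is_derive t 1 (fun t : R => expR (- t^-1)) (expR (- t^-1) * t^-2).
    rewrite -[t ^- 2]opprK.
    exact: (is_derive_comp (is_deriveN dV) (is_derive_expR _)).
  have := is_deriveM dX dE; rewrite mulrfctE => /is_derive_eq; apply.
  rewrite /flat_exp t0 /GRing.scale/=.
  rewrite -exprVn; case: k {dX} => [|k] /=; rewrite ?expr0 ?exprS; ring.
- rewrite !flat_exp_le0// mulr0 subr0.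
  have D : h^-1 *: (flat_exp k (h *: 1 + 0) - flat_exp k 0) @[h --> 0^'] --> (0 : R).
    apply/cvgr0Pnorm_le => e e0; near=> h.
    have h0 : h != 0 by near: h; exact: nbhs_dnbhs_neq.
    rewrite [h *: 1]mulr1 addr0 (flat_exp_le0 _ (lexx 0)) subr0 normrZ normfV.
    rewrite (ger0_norm (flat_exp_ge0 _ _)) ler_pdivrMl ?normr_gt0//.
    rewrite (le_trans (flat_exp_le_sqr _ _))//.
    rewrite -real_normK ?num_real// expr2 mulrCA ler_wpM2l//.
    rewrite -ler_pdivlMl ?ltr0n ?fact_gt0//.
    near: h; apply: dnbhs0_le; rewrite mulr_gt0// invr_gt0 ltr0n fact_gt0//.
  apply: DeriveDef; first by apply/cvg_ex; exists 0.
  exact: cvg_lim D.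
Unshelve. all: by end_near. Qed.
End flat_exp_theory.

(** * Smoothness and Laplacian of the radial cutoffs *)

Section cutoff.
Context {R : realType} {n : nat}.
Implicit Types (f g : 'rV[R]_n -> R) (x v : 'rV[R]_n).

Definition sqnorm x : R := \sum_(i < n) x 0 i ^+ 2.

Lemma sqnorm_ge0 x : 0 <= sqnorm x.
Proof. by apply: sumr_ge0 => i _; rewrite sqr_ge0. Qed.

Lemma continuous_sqnorm : continuous sqnorm.
Proof.
apply: continuous_big; first exact: add_continuous.
move=> i _; under eq_fun do rewrite expr2.
by move=> x; apply: continuousM; exact: coord_continuous.
Qed.

Lemma is_derive_coord (j : 'I_n) x v :
  is_derive x v (fun y : 'rV[R]_n => y 0 j) (v 0 j).
Proof.
have dI : derivable (@id 'rV[R]_n) x v by exact: derivable_id.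
have /derivable_mxP/(_ 0 j) dj := dI.
apply: DeriveDef => //.
have := derive_mx dI; rewrite derive_id => /matrixP/(_ 0 j).
by rewrite mxE => <-.
Qed.

Lemma is_derive_sqnorm x v :
  is_derive x v sqnorm (\sum_(i < n) 2 * x 0 i * v 0 i).
Proof.
have -> : sqnorm = \sum_(i < n) (fun y : 'rV[R]_n => y 0 i) ^+ 2.
  by apply/funext => y; rewrite fct_sumE; apply: eq_bigr => i _; rewrite exprfctE.
have dX (i : 'I_n) := @is_deriveX R 'rV[R]_n _ 2 x v _ (is_derive_coord i x v).
have := @is_derive_sum R 'rV[R]_n R n _ x v _ dX.
by move=> /is_derive_eq; apply; apply: eq_bigr => i _; rewrite expr1.
Qed.

Lemma is_derive_flat_exp_sqnorm k (a b : R) (i : 'I_n) x :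
  is_derive x (delta_mx 0 i) (fun y => flat_exp k (b - a * sqnorm y))
    ((flat_exp k.+2 (b - a * sqnorm x) - k%:R * flat_exp k.+1 (b - a * sqnorm x)) *
      (- (2 * a * x 0 i))).
Proof.
have dq : is_derive x (delta_mx 0 i) (fun y => b - a * sqnorm y)
    (- (2 * a * x 0 i)).
  have := is_deriveB (is_derive_cst b x (delta_mx 0 i))
    (is_deriveZ a (is_derive_sqnorm x (delta_mx 0 i))).
  move=> /is_derive_eq; apply.
  rewrite sub0r (bigD1 i)//= big1 => [|j ji]; last first.
    by rewrite mxE (negbTE ji) andbF mulr0.
  by rewrite mxE !eqxx mulr1 addr0 /GRing.scale/= mulrCA mulrA.
exact: (is_derive_comp dq (is_derive_flat_exp _ _)).
Qed.

(* A class of functions that is closed under partial derivatives and contains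
   the cutoffs, which makes them smooth. *)
Inductive cutoff_alg (a b : R) : ('rV[R]_n -> R) -> Prop :=
| CutoffCst c : cutoff_alg a b (fun=> c)
| CutoffCoord i : cutoff_alg a b (fun x => x 0 i)
| CutoffBump k : cutoff_alg a b (fun x => flat_exp k (b - a * sqnorm x))
| CutoffAdd f g : cutoff_alg a b f -> cutoff_alg a b g ->
    cutoff_alg a b (fun x => f x + g x)
| CutoffMul f g : cutoff_alg a b f -> cutoff_alg a b g ->
    cutoff_alg a b (fun x => f x * g x).

Lemma cutoff_alg_continuous a b f : cutoff_alg a b f -> continuous f.
Proof.
elim=> {f} [c|i|k|f g _ cf _ cg|f g _ cf _ cg] x.
- exact: cst_continuous.
- exact: coord_continuous.
- apply: (@continuous_comp _ _ _ (fun x => b - a * sqnorm x) (flat_exp k)).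
    apply: continuousB; first exact: cst_continuous.
    by apply: continuousM; [exact: cst_continuous|exact: continuous_sqnorm].
  apply: differentiable_continuous; apply/derivable1_diffP.
  by have [] := is_derive_flat_exp k (b - a * sqnorm x).
- by apply: continuousD; [exact: cf|exact: cg].
- by apply: continuousM; [exact: cf|exact: cg].
Qed.

Lemma cutoff_alg_derive a b f i : cutoff_alg a b f ->
  exists2 f', cutoff_alg a b f' & forall x, is_derive x (delta_mx 0 i) f (f' x).
Proof.
elim=> {f} [c|j|k|f g af [f' af' df] ag [g' ag' dg]
  |f g af [f' af' df] ag [g' ag' dg]].
- by exists (fun=> 0); [exact: CutoffCst|move=> x; exact: is_derive_cst].
- exists (fun=> (delta_mx 0 i : 'rV[R]_n) 0 j); first exact: CutoffCst.
  by move=> x; exact: is_derive_coord.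
- eexists; last by move=> x; exact: is_derive_flat_exp_sqnorm.
  apply: CutoffMul.
    apply: CutoffAdd; first exact: CutoffBump.
    under eq_fun do rewrite -mulNr.
    by apply: CutoffMul; [exact: CutoffCst|exact: CutoffBump].
  under eq_fun do rewrite -mulNr.
  by apply: CutoffMul; [exact: CutoffCst|exact: CutoffCoord].
- exists (fun x => f' x + g' x); first exact: CutoffAdd.
  by move=> x; exact: is_deriveD.
- exists (fun x => f x * g' x + g x * f' x).
    by apply: CutoffAdd; apply: CutoffMul.
  by move=> x; exact: is_deriveM.
Qed.

Lemma partial_is_derive f f' i :
  (forall x, is_derive x (delta_mx 0 i) f (f' x)) -> partial i f = f'.
Proof. by move=> df; apply/funext => x; rewrite /partial derive_val. Qed.

Lemma cutoff_alg_smooth a b f : cutoff_alg a b f -> smooth f.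
Proof.
move=> af k.
have ap s : cutoff_alg a b (partials s f).
  elim: s => //= i s /cutoff_alg_derive => /(_ i)[g ag /partial_is_derive].
  by rewrite /= => ->.
split=> [s _|s i x _]; first exact: cutoff_alg_continuous (ap s).
by have [g _ /(_ x)[]] := cutoff_alg_derive i (ap s).
Qed.

(** For g = [flat_exp 0] one has g' = [flat_exp 2] and g'' = [flat_exp 4 - 2 * flat_exp 3], so this
    is 4 a^2 |x|^2 g'' - 2 n a g'. Apart from the leading factor [a], only the product
    [a * sqnorm x] occurs, which makes the behaviour under dilation immediate. *)
Lemma laplacian_flat_exp (a b : R) x :
  laplacian (fun y => flat_exp 0 (b - a * sqnorm y)) x =
  a * (4 * (a * sqnorm x) *
         (flat_exp 4 (b - a * sqnorm x) - 2 * flat_exp 3 (b - a * sqnorm x)) -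
       2 * n%:R * flat_exp 2 (b - a * sqnorm x)).
Proof.
rewrite /laplacian.
have d1 i : partial i (fun y => flat_exp 0 (b - a * sqnorm y)) =
    fun y => flat_exp 2 (b - a * sqnorm y) * (- (2 * a) * y 0 i).
  rewrite (partial_is_derive (is_derive_flat_exp_sqnorm 0 a b i)).
  by apply/funext => y; rewrite mul0r subr0 mulNr.
have d2 i : partial i (partial i (fun y => flat_exp 0 (b - a * sqnorm y))) x =
    (flat_exp 4 (b - a * sqnorm x) - 2 * flat_exp 3 (b - a * sqnorm x)) *
      (4 * a ^+ 2) * x 0 i ^+ 2 + flat_exp 2 (b - a * sqnorm x) * (- (2 * a)).
  have dd y : is_derive y (delta_mx 0 i)
      (fun y => flat_exp 2 (b - a * sqnorm y) * (- (2 * a) * y 0 i))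
      (flat_exp 2 (b - a * sqnorm y) * (- (2 * a)) +
       (- (2 * a) * y 0 i) * ((flat_exp 4 (b - a * sqnorm y) -
         2 * flat_exp 3 (b - a * sqnorm y)) * (- (2 * a * y 0 i)))).
    have dl := is_deriveZ (- (2 * a)) (is_derive_coord i y (delta_mx 0 i)).
    have := is_deriveM (is_derive_flat_exp_sqnorm 2 a b i y) dl.
    by move=> /is_derive_eq; apply; rewrite mxE !eqxx /GRing.scale/= mulr1.
  rewrite d1 (partial_is_derive dd); ring.
under eq_bigr do rewrite d2.
rewrite big_split/= -mulr_sumr sumr_const card_ord -/(sqnorm x) -mulr_natr.
ring.
Qed.

End cutoff.

(** * Dilations and Lebesgue integrals on row vectors *)

Section scaling.
Context {R : realType}.
Local Open Scope ereal_scope.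

Let mu := @lebesgue_measure R.

Lemma measurable_mulr (r : R) :
  measurable_fun setT ( *%R r : measurableTypeR R -> measurableTypeR R).
Proof. exact: measurable_funM. Qed.

Lemma ge0_integral_lebesgue_scale (r : R) (f : measurableTypeR R -> \bar R) :
  (0 < r)%R -> measurable_fun setT f -> (forall t, 0 <= f t) ->
  \int[mu]_t f t = r%:E * \int[mu]_t f (r * t)%R.
Proof.
move=> r0 mf f0.
have rge0 := ltW r0.
rewrite -(@ge0_integral_pushforward _ _ _ _ _ _ (measurable_mulr r) mu setT f)//.
rewrite -(@ge0_integral_mscale _ _ _ _ _ measurableT (NngNum rge0))//.
apply: eq_measure_integral => A mA _.
(* Lebesgue measure is determined by the lengths of the intervals ]a, b]; the preimage of such an
   interval under multiplication by [r] is ]a/r, b/r], and the factor [r] restores its length. *)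
apply: lebesgue_measure_unique => //= _ [[a b]] _ <-.
rewrite /mscale/= /pushforward.
rewrite [X in _ * _ X](_ : _ = `](a / r)%R, (b / r)%R]%classic); last first.
  apply/seteqP; split=> x /=; rewrite !in_itv/=;
    by rewrite ltr_pdivrMr// ler_pdivlMr// mulrC.
rewrite /mu !lebesgue_measure_itv/= !lte_fin ltr_pM2r ?invr_gt0//.
case: ifP => _; rewrite ?mule0// -EFinD -EFinM; congr EFin.
by field; rewrite gt_eqF.
Qed.

Lemma cons_rVZ n (r t : R) (x : 'rV[R]_n) :
  (r *: cons_rV (t, x) = cons_rV (r * t, r *: x))%R.
Proof.
apply/rowP => j; have [i|] := unliftP 0%R j => ->.
  by rewrite mxE !cons_rV_lift mxE.
by rewrite mxE !cons_rV0.
Qed.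

Lemma ge0_integral_lebesgue_rVS n (f : 'rV[R]_n.+1 -> \bar R) :
  measurable_fun setT f -> (forall x, 0 <= f x) ->
  \int[lebesgue_rV n.+1]_x f x =
  \int[mu]_t \int[lebesgue_rV n]_x f (cons_rV (t, x)).
Proof.
move=> mf f0.
have mg : measurable_fun setT (f \o @cons_rV R n).
  by apply: measurableT_comp => //; exact: measurable_cons_rV.
rewrite -(fubini_tonelli1 (m1 := mu) (m2 := lebesgue_rV n)
  (f \o @cons_rV R n) mg); last by move=> x; exact: f0.
have mc : measurable_fun setT
    (@cons_rV R n : measurableTypeR R * 'rV[R]_n -> 'rV[R]_n.+1).
  exact: measurable_cons_rV.
rewrite -(ge0_integral_pushforward mc (mu \x lebesgue_rV n) measurableT mf)//.
Qed.

Lemma measurable_scaler_rV n (r : R) :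
  measurable_fun setT (fun x : 'rV[R]_n => (r *: x)%R).
Proof.
apply: measurable_fun_rV => j; under eq_fun do rewrite mxE.
by apply: measurable_funM => //; exact: measurable_coord.
Qed.

(** Induction on the dimension: Tonelli splits off the first coordinate, which contributes one
    factor [r], and the induction hypothesis contributes [r ^+ n] for the others. *)
Lemma ge0_integral_lebesgue_rV_scale n (r : R) (f : 'rV[R]_n -> \bar R) :
  (0 < r)%R -> measurable_fun setT f -> (forall x, 0 <= f x) ->
  \int[lebesgue_rV n]_x f x = (r ^+ n)%:E * \int[lebesgue_rV n]_x f (r *: x)%R.
Proof.
move=> r0; elim: n f => [|n IHn] f mf f0.
  rewrite expr0 mul1e; apply: eq_integral => x _; congr f.
  by apply/rowP => -[].
have mcons t : measurable_fun setT (fun x : 'rV[R]_n => f (cons_rV (t, x))).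
  apply: (measurableT_comp mf).
  exact: (measurableT_comp (@measurable_cons_rV R n)).
have mfs : measurable_fun setT (fun x : 'rV[R]_n.+1 => f (r *: x)%R).
  exact: (measurableT_comp mf (measurable_scaler_rV _)).
rewrite !ge0_integral_lebesgue_rVS//.
under [in RHS]eq_integral do under eq_integral do rewrite cons_rVZ.
rewrite (@ge0_integral_lebesgue_scale r)//; last 2 first.
- apply: (@measurable_fun_fubini_tonelli_F _ _ _ _ _ (lebesgue_rV n)
    (fun p => f (cons_rV p))) => //.
  by apply: (measurableT_comp mf); exact: measurable_cons_rV.
- by move=> t; exact: integral_ge0.
transitivity (r%:E * \int[mu]_t ((r ^+ n)%:E *
    \int[lebesgue_rV n]_x f (cons_rV (r * t, r *: x)%R))).
  by congr (_ * _); apply: eq_integral => t _; rewrite IHn.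
rewrite ge0_integralZl//; last 3 first.
- apply: (@measurable_fun_fubini_tonelli_F _ _ _ _ _ (lebesgue_rV n)
    (fun p : measurableTypeR R * 'rV[R]_n => f (cons_rV (r * p.1, r *: p.2)%R))).
  + under eq_fun do rewrite -cons_rVZ.
    apply: (measurableT_comp mfs).
    by apply: (eq_measurable_fun (@cons_rV R n)) => [[]//|]; exact: measurable_cons_rV.
  + by move=> p; exact: f0.
- by move=> t _; exact: integral_ge0.
- by rewrite lee_fin exprn_ge0// ltW.
by rewrite muleA -EFinM -exprS.
Qed.

End scaling.

(** * Polynomial functions: the top-degree part and growth bounds *)

Section polynomial_functions.
Import -(notations) mpoly.

(** The residue modulo [b] recovers the lowest digit; cancelling it and dividing by [b] leaves the
    others to induction. *)
Lemma eq_digits (b n : nat) (u v : 'I_n -> nat) :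
  (forall i, u i < b)%N -> (forall i, v i < b)%N ->
  (\sum_(i < n) u i * b ^ i = \sum_(i < n) v i * b ^ i)%N -> u =1 v.
Proof.
elim: n u v => [|n IHn] u v ub vb; first by move=> _ [].
rewrite !big_ord_recl/= expn0 !muln1 => e.
have tail (w : 'I_n.+1 -> nat) : (\sum_(i < n) w (lift ord0 i) * b ^ bump 0 i =
    (\sum_(i < n) w (lift ord0 i) * b ^ i) * b)%N.
  by rewrite big_distrl/=; apply: eq_bigr => i _; rewrite expnSr mulnA.
rewrite !tail in e.
have e0 : u ord0 = v ord0.
  move: e => /(congr1 (modn ^~ b)).
  by rewrite ![(_ ord0 + _)%N]addnC !modnMDl !modn_small.
move: e; rewrite e0 => /addnI/eqP.
rewrite eqn_pmul2r ?(leq_trans _ (ub ord0))// => /eqP e.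
have et := IHn (fun i => u (lift ord0 i)) (fun i => v (lift ord0 i))
  (fun i => ub _) (fun i => vb _) e.
by move=> i; have [j|] := unliftP ord0 i => ->.
Qed.

(** The numbers 0, ..., [size q] - 1 are pairwise distinct and too many to be all roots of [q]. *)
Lemma poly_nonroot (R : numDomainType) (q : {poly R}) :
  q != 0 -> exists t, q.[t] != 0.
Proof.
move=> q0; apply: contrapT => /forallNP q_eq0.
have := @max_poly_roots _ q [seq i%:R | i <- iota 0 (size q)] q0.
rewrite size_map size_iota ltnn => /(_ _ _)/negP; apply => //.
  apply/allP => t _; apply/negPn/negP; exact: q_eq0.
by rewrite map_inj_uniq ?iota_uniq// => i j /eqP; rewrite eqr_nat => /eqP.
Qed.

Context {R : realType} {n : nat}.

(** The predicate lets one definition serve for the whole polynomial, its homogeneous part of top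
    degree and the remainder. *)
Definition monomials (p : mpoly n R) (P : pred (multinom n)) (x : 'rV[R]_n) : R :=
  \sum_(m <- msupp p | P m) mcoeff m p * \prod_i x 0 i ^+ m i.

(* Kronecker substitution x_i = t^(b^i): distinct exponent vectors with entries
   below b give distinct powers of t. *)
Lemma monomials_neq0 (p : mpoly n R) (P : pred (multinom n)) m0 :
  m0 \in msupp p -> P m0 -> exists x, monomials p P x != 0.
Proof.
move=> m0p Pm0; pose b := msize p.
pose k (m : multinom n) := (\sum_(i < n) m i * b ^ i)%N.
(* The base [msize p] exceeds the total degree, hence every single exponent, so the exponents are
   legitimate digits. *)
have mb m : m \in msupp p -> forall i, (m i < b)%N.
  move=> /msize_mdeg_lt mp i; apply: leq_ltn_trans mp.
  by rewrite mdegE (bigD1 i)//= leq_addr.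
pose q := \sum_(m <- msupp p | P m) mcoeff m p *: 'X^(k m).
have q0 : q != 0.
  apply/eqP => /(congr1 (fun q : {poly R} => q`_(k m0))).
  rewrite coef0 coef_sum -big_filter.
  rewrite (bigD1_seq m0) ?mem_filter ?Pm0 ?filter_uniq ?msupp_uniq//=.
  rewrite coefZ coefXn eqxx mulr1 big_seq_cond big1 ?addr0; last first.
    move=> m; rewrite mem_filter => /andP[/andP[_ mp] mm0].
    rewrite coefZ coefXn; case: eqP => [e|_]; last by rewrite mulr0.
    have em : m0 = m by apply/mnmP; apply: eq_digits e; exact: mb.
    by rewrite em eqxx in mm0.
  by apply/eqP; rewrite -mcoeff_msupp.
have [t qt] := poly_nonroot q0.
exists (\row_i t ^+ (b ^ i)); move: qt; apply: contra_neq => <-.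
rewrite horner_sum; apply: eq_bigr => m _.
rewrite hornerZ hornerXn; congr (_ * _).
by rewrite -prodrXr; apply: eq_bigr => i _; rewrite mxE mulnC exprM.
Qed.

Lemma continuous_monomials (p : mpoly n R) P : continuous (monomials p P).
Proof.
apply: continuous_big; first exact: add_continuous.
move=> m _ x; apply: continuousM; first exact: cst_continuous.
move: x; apply: continuous_big; first exact: mul_continuous.
move=> i _ x; apply: (@continuous_comp _ _ _ (fun x : 'rV[R]_n => x 0 i)
  (fun y => y ^+ m i)); first exact: coord_continuous.
exact: exprn_continuous.
Qed.

Lemma monomials_homog p d t x :
  monomials p (fun m => mdeg m == d) (t *: x) =
  t ^+ d * monomials p (fun m => mdeg m == d) x.
Proof.
rewrite /monomials mulr_sumr; apply: eq_bigr => m /eqP <-.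
rewrite mulrCA; congr (_ * _); rewrite mdegE -prodrXr -big_split/=.
by apply: eq_bigr => i _; rewrite mxE exprMn.
Qed.

(** [M] is the sum of the absolute values of the selected coefficients; [1 <= r] allows every lower
    power of [r] to be raised to [r ^+ d]. *)
Lemma monomials_bound (p : mpoly n R) (P : pred (multinom n)) d :
  (forall m, P m -> (mdeg m <= d)%N) ->
  exists2 M, 0 <= M & forall r (x : 'rV[R]_n), 1 <= r ->
    (forall i, `|x 0 i| <= r) -> `|monomials p P x| <= M * r ^+ d.
Proof.
move=> Pd; exists (\sum_(m <- msupp p | P m) `|mcoeff m p|).
  by apply: sumr_ge0.
move=> r x r1 xr; rewrite mulr_suml; apply: le_trans (ler_norm_sum _ _ _) _.
apply: ler_sum => m /Pd md; rewrite normrM ler_wpM2l//.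
apply: le_trans (ler_weXn2l r1 md).
rewrite normr_prod mdegE -prodrXr; apply: ler_prod => i _.
by rewrite normrX exprn_ge0//= lerXn2r// ?nnegrE// (le_trans _ r1).
Qed.

(** [H] is the homogeneous part of top degree, nonzero because it contains the leading monomial.
    With the degree written [d.+1], the remainder [h - H] grows with exponent [d], one power less
    than [H]. *)
Lemma polynomial_of_degreeE d (h : 'rV[R]_n -> R) :
  polynomial_of_degree d.+1 h -> exists H : 'rV[R]_n -> R,
  [/\ continuous h, continuous H, (forall t x, H (t *: x) = t ^+ d.+1 * H x),
    (exists x, H x != 0) &
    exists2 M, 0 <= M & forall r (x : 'rV[R]_n), 1 <= r ->
      (forall i, `|x 0 i| <= r) ->
      `|h x - H x| <= M * r ^+ d /\ `|H x| <= M * r ^+ d.+1].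
Proof.
move=> [p pd hp]; exists (monomials p (fun m => mdeg m == d.+1)).
have p0 : p != 0 by rewrite -msize_poly_eq0 pd.
have hE : h = monomials p xpredT.
  by apply/funext => x; rewrite hp mevalE.
have hB x : h x - monomials p (fun m => mdeg m == d.+1) x =
    monomials p (fun m => (mdeg m <= d)%N) x.
  rewrite hE /monomials (bigID (fun m => mdeg m == d.+1))/= [LHS]addrC addKr.
  rewrite big_seq_cond [RHS]big_seq_cond; apply: eq_bigl => m.
  case: (boolP (m \in msupp p)) => //= /msize_mdeg_lt; rewrite pd ltnS => md.
  by rewrite [in RHS]leqNgt leq_eqVlt in md *; case: ltngtP md.
split.
- by rewrite hE; exact: continuous_monomials.
- exact: continuous_monomials.
- by move=> t x; exact: monomials_homog.
- apply: (@monomials_neq0 _ _ (mlead p)); first exact: mlead_supp.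
  by apply/eqP/succn_inj; rewrite mlead_deg.
- have [M M0 Mb] := @monomials_bound p (fun m => mdeg m <= d)%N d (fun=> id).
  have [|N N0 Nb] := @monomials_bound p (fun m => mdeg m == d.+1) d.+1.
    by move=> m /eqP ->.
  exists (M + N); first exact: addr_ge0.
  move=> r x r1 xr; have r0 : 0 <= r by exact: le_trans r1.
  by split; rewrite ?hB; [apply: le_trans (Mb _ _ r1 xr) _|
    apply: le_trans (Nb _ _ r1 xr) _];
    apply: ler_wpM2r; rewrite ?exprn_ge0 ?lerDl ?lerDr.
Qed.

End polynomial_functions.

(** * Real integrals of functions supported in cubes *)

Section integrals.
Context {R : realType} {n : nat}.
Implicit Types (f : 'rV[R]_n -> R) (x : 'rV[R]_n).
Local Notation lam := (@lebesgue_rV R n).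

(** Cubes, not Euclidean balls, carry the integral estimates: their Lebesgue measure is a product of
    side lengths. *)
Definition cube x (r : R) : set 'rV[R]_n :=
  [set y | forall i, `|x 0 i - y 0 i| <= r].

Lemma cubeE x r : cube x r =
  [set y | forall i, `[x 0 i - r, x 0 i + r]%classic (y 0 i)].
Proof.
apply/seteqP; split=> y + i => /(_ i)/=;
  by rewrite in_itv/= distrC ler_distl.
Qed.

Lemma measurable_cube x r : measurable (cube x r).
Proof.
rewrite cubeE [X in measurable X](_ : _ = \bigcap_(j in [set: 'I_n])
    ((fun y : 'rV[R]_n => y 0 j) @^-1` `[x 0 j - r, x 0 j + r]%classic)).
  apply: fin_bigcap_measurable => // j _.
  by rewrite -[X in measurable X]setTI; exact: measurable_coord.
by apply/seteqP; split=> [y Ay j _|y Ay j]; exact: Ay.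
Qed.

Lemma lebesgue_rV_cube x r : 0 <= r -> lam (cube x r) = ((2 * r) ^+ n)%:E.
Proof.
move=> r0; rewrite cubeE.
rewrite (@lebesgue_rV_box R n (fun i => `[x 0 i - r, x 0 i + r]%classic))//.
under eq_bigr do rewrite lebesgue_measure_itv/= lte_fin.
rewrite -[X in (2 * r) ^+ X]card_ord -prodr_const -prodEFin.
apply: eq_bigr => i _; case: ltP => xr; last by congr EFin; lra.
by rewrite -EFinD; congr EFin; ring.
Qed.

Lemma integral_cube x (c r : R) : 0 <= c -> 0 <= r ->
  (\int[lam]_y (c * \1_(cube x r) y)%:E)%E = (c * (2 * r) ^+ n)%:E.
Proof.
move=> c0 r0; under eq_integral do rewrite EFinM.
rewrite (@integralZl_indic _ _ _ _ _ measurableT (fun=> cube x r))//; last 2 first.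
- by move=> c0'; move: c0; rewrite leNgt c0'.
- exact: measurable_cube.
rewrite integral_indic ?setIT//; last exact: measurable_cube.
by rewrite EFinM; congr (_ * _)%E; exact: lebesgue_rV_cube.
Qed.

Lemma integrable_cube f (M r : R) : 0 <= M -> 0 <= r -> measurable_fun setT f ->
  (forall x, cube 0 r x -> `|f x| <= M) -> (forall x, f x != 0 -> cube 0 r x) ->
  lam.-integrable setT (EFin \o f) /\
  `|\int[lam]_x f x| <= M * (2 * r) ^+ n.
Proof.
move=> M0 r0 mf fM fr.
have dom x : (`|(f x)%:E| <= (M * \1_(cube 0 r) x)%:E)%E.
  rewrite lee_fin indicE; case: (boolP (x \in cube 0 r)) => [|/negP xr].
    by rewrite inE mulr1 => /fM.
  have [->|/fr xr'] := eqVneq (f x) 0; first by rewrite normr0 mulr0.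
  by exfalso; apply: xr; rewrite inE.
have mc : measurable_fun setT (fun x => (M * \1_(cube 0 r) x)%:E).
  apply/measurable_EFinP; apply: measurable_funM => //.
  by apply: measurable_indic; exact: measurable_cube.
have I : (\int[lam]_x `|(f x)%:E| <= (M * (2 * r) ^+ n)%:E)%E.
  apply: le_trans; first apply: ge0_le_integral => //.
  - by apply: measurableT_comp => //; exact/measurable_EFinP.
  - exact: mc.
  - by move=> x _; exact: dom.
  by rewrite integral_cube.
have int : lam.-integrable setT (EFin \o f).
  apply/integrableP; split; first exact/measurable_EFinP.
  by apply: le_lt_trans I _; rewrite ltry.
split=> //.
apply: le_trans (le_normr_Rintegral _ _) _ => //.
rewrite -lee_fin /Rintegral fineK//.
by rewrite ge0_fin_numE ?integral_ge0//; apply: le_lt_trans I _; rewrite ltry.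
Qed.

(** Apply the nonnegative case to the positive and negative parts; applied to the absolute value, it
    also carries integrability over to the dilated function. *)
Lemma Rintegral_scale r f : 0 < r -> lam.-integrable setT (EFin \o f) ->
  \int[lam]_x f x = r ^+ n * \int[lam]_x f (r *: x).
Proof.
move=> r0 intf; have [mf _] := integrableP _ _ _ intf.
have mfr : measurable_fun setT (fun x : 'rV[R]_n => (f (r *: x))%:E).
  exact: (measurableT_comp mf (measurable_scaler_rV _)).
have intfr : lam.-integrable setT (EFin \o (fun x => f (r *: x))).
  apply/integrableP; split => //; rewrite /comp ltNge leye_eq; apply/negP => /eqP e.
  have [_] := integrableP _ _ _ intf; rewrite /comp.
  rewrite (ge0_integral_lebesgue_rV_scale r0)//.
    by rewrite e gt0_muley ?ltxx// lte_fin exprn_gt0.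
  exact: measurableT_comp.
pose fr x := f (r *: x).
have sp : (\int[lam]_x (EFin \o f)^\+ x =
    (r ^+ n)%:E * \int[lam]_x (EFin \o fr)^\+ x)%E.
  rewrite (ge0_integral_lebesgue_rV_scale r0 (measurable_funepos mf))//.
  by congr (_ * _)%E; apply: eq_integral => x _; rewrite !funeposE.
have sn : (\int[lam]_x (EFin \o f)^\- x =
    (r ^+ n)%:E * \int[lam]_x (EFin \o fr)^\- x)%E.
  rewrite (ge0_integral_lebesgue_rV_scale r0 (measurable_funeneg mf))//.
  by congr (_ * _)%E; apply: eq_integral => x _; rewrite !funenegE.
rewrite /Rintegral integralE sp sn [in RHS]integralE.
rewrite -(fineK (integrable_pos_fin_num measurableT intfr)).
by rewrite -(fineK (integrable_neg_fin_num measurableT intfr))/= mulrBr.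
Qed.

Lemma integral_continuous_gt0 f x : continuous f -> (forall y, 0 <= f y) ->
  0 < f x -> (0 < \int[lam]_y (f y)%:E)%E.
Proof.
move=> cf f0 fx.
have fx2 : f x / 2 < f x by rewrite ltr_pdivrMr// ltr_pMr// ltr1n.
have /nbhs_ballP[e /= e0 xef] := cf x [set t | f x / 2 < t] (lt_nbhsr fx2).
have e20 : 0 < e / 2 by rewrite divr_gt0.
(* Half of the radius [e], because the cube is closed while [ball] is defined by a strict
   inequality. *)
have dom y : ((f x / 2 * \1_(cube x (e / 2)) y)%:E <= (f y)%:E)%E.
  rewrite lee_fin indicE; case: (boolP (y \in _)) => [|_]; last by rewrite mulr0.
  rewrite inE mulr1 => xy; apply/ltW/xef; split=> // i j.
  rewrite ord1 /ball/=; apply: le_lt_trans (xy j) _.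
  by rewrite ltr_pdivrMr// ltr_pMr// ltr1n.
apply: (@lt_le_trans _ _ (\int[lam]_y (f x / 2 * \1_(cube x (e / 2)) y)%:E)%E).
  rewrite integral_cube ?ltW ?divr_gt0// lte_fin.
  by rewrite mulr_gt0 ?divr_gt0 ?exprn_gt0 ?mulr_gt0.
apply: ge0_le_integral => //.
- by move=> y _; rewrite lee_fin mulr_ge0// divr_ge0// ltW.
- apply/measurable_EFinP; apply: measurable_funM => //.
  by apply: measurable_indic; exact: measurable_cube.
- by apply/measurable_EFinP; exact: continuous_measurable_rV.
Qed.

End integrals.

(** * Euler's identity for homogeneous functions in integrated form *)

Section homogeneous_weight.
Context {R : realType} {n : nat}.
Implicit Types (f F : 'rV[R]_n -> R) (x : 'rV[R]_n).
Local Notation lam := (@lebesgue_rV R n).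

Lemma sqnormZ (t : R) x : sqnorm (t *: x) = t ^+ 2 * sqnorm x.
Proof.
by rewrite /sqnorm mulr_sumr; apply: eq_bigr => i _; rewrite mxE exprMn.
Qed.

Lemma sqnorm_cube (r : R) x : 0 <= r -> sqnorm x <= r ^+ 2 -> cube 0 r x.
Proof.
move=> r0 xr i; rewrite mxE sub0r normrN -(ler_pXn2r (_ : (0 < 2)%N))//.
rewrite real_normK ?num_real//; apply: le_trans xr.
by rewrite /sqnorm (bigD1 i)//= lerDl sumr_ge0// => j _; rewrite sqr_ge0.
Qed.

(** The bound of [flat_exp_le_sqr] at t = 4, the largest value of the arguments 4 - a |x|^2 with a
    >= 0. *)
Definition flat_exp_ub (k : nat) : R := (k.+2)`!%:R * 16.

Lemma flat_exp_ub_ge0 k : 0 <= flat_exp_ub k.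
Proof. by rewrite mulr_ge0. Qed.

Lemma flat_exp_le_ub k (t : R) : t <= 4 -> flat_exp k t <= flat_exp_ub k.
Proof.
move=> t4; have [t0|/flat_exp_le0 ->] := ltP 0 t; last exact: flat_exp_ub_ge0.
apply: le_trans (flat_exp_le_sqr _ _) _.
rewrite /flat_exp_ub; apply: ler_wpM2l; [by rewrite ler0n|nra].
Qed.

Lemma norm_flat_exp k (t : R) : t <= 4 -> `|flat_exp k t| <= flat_exp_ub k.
Proof. by move=> t4; rewrite ger0_norm ?flat_exp_ge0//; exact: flat_exp_le_ub. Qed.

Lemma continuous_flat_exp_sqnorm k (a b : R) :
  continuous (fun x => flat_exp k (b - a * sqnorm x)).
Proof. exact: cutoff_alg_continuous (CutoffBump _ _ _). Qed.

Lemma measurable_flat_exp_sqnorm k (a b : R) :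
  measurable_fun setT (fun x => flat_exp k (b - a * sqnorm x)).
Proof.
by apply: continuous_measurable_rV; exact: continuous_flat_exp_sqnorm.
Qed.

Variables (F : 'rV[R]_n -> R) (d : nat) (B : R).
Hypothesis mF : measurable_fun setT F.
Hypothesis homF : forall t x, 0 < t -> F (t *: x) = t ^+ d * F x.
Hypothesis B0 : 0 <= B.
Hypothesis FB : forall x, cube 0 4 x -> `|F x| <= B.

(** For t > 0, homogeneity makes this t^-d times [f 1 (t *: x)]. The parameter thus sits in the
    smooth weight only, although [F] may fail to be differentiable. *)
Let f (t : R) x : R := F x * flat_exp 2 (4 - t ^+ 2 * sqnorm x).

Let df (t : R) x : R := F x * ((flat_exp 4 (4 - t ^+ 2 * sqnorm x) -
  2 * flat_exp 3 (4 - t ^+ 2 * sqnorm x)) * (- (2 * t * sqnorm x))).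

Let t2_sqnorm (t : R) x : t ^+ 2 * sqnorm x >= 0.
Proof. by rewrite mulr_ge0 ?sqr_ge0 ?sqnorm_ge0. Qed.

(** For t > 1/2 the supports of all [f t] lie in one fixed cube of half-side 4. This is what permits
    a single dominating function on the parameter interval ]1/2, 2[. *)
Let supp (t : R) x : 1 / 2 < t -> 0 < 4 - t ^+ 2 * sqnorm x -> sqnorm x <= 4 ^+ 2.
Proof. by move=> t0 h; have s0 := sqnorm_ge0 x; nra. Qed.

Let intf (t : R) : 1 / 2 < t -> lam.-integrable setT (EFin \o f t).
Proof.
move=> t0.
have [|//||||//] := @integrable_cube R n (f t) (B * flat_exp_ub 2) 4.
- by rewrite mulr_ge0 ?flat_exp_ub_ge0.
- by apply: measurable_funM => //; exact: measurable_flat_exp_sqnorm.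
- move=> x x4; rewrite normrM ler_pM ?FB// norm_flat_exp//.
  by rewrite gerBl t2_sqnorm.
- move=> x; rewrite mulf_eq0 negb_or => /andP[_ g0].
  apply: sqnorm_cube => //; apply: (supp t0); rewrite ltNge.
  by apply: contra g0 => /flat_exp_le0 ->.
Qed.

Let is_derive_f (t : R) x : is_derive t 1 (f ^~ x) (df t x).
Proof.
have dq : is_derive t 1 (fun t : R => 4 - t ^+ 2 * sqnorm x)
    (- (2 * t * sqnorm x)).
  have dX : is_derive t 1 (fun t : R => t ^+ 2) (2 * t).
    have := is_deriveX 2 (is_derive_id t (1 : R)).
    by rewrite exprfctE => /is_derive_eq; apply; rewrite /GRing.scale/= mulr1.
  have dZ := is_deriveZ (sqnorm x) dX.
  have := is_deriveB (is_derive_cst (4 : R) t 1) dZ.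
  rewrite (_ : _ - _ = fun t : R => 4 - t ^+ 2 * sqnorm x).
    by move=> /is_derive_eq; apply; rewrite /GRing.scale/=; ring.
  by apply/funext => s; rewrite /= !fctE /GRing.scale/= mulrC.
have := is_deriveZ (F x) (is_derive_comp dq (is_derive_flat_exp 2 _)).
exact.
Qed.

(** The factor 64 bounds 2 t |x|^2 for t < 2 and |x|^2 <= 16. *)
Let ub : R := B * ((flat_exp_ub 4 + 2 * flat_exp_ub 3) * 64).

Let df_ub (t : R) x : 1 / 2 < t -> t < 2 ->
  `|df t x| <= ub * \1_(cube 0 4) x.
Proof.
move=> t0 t2; rewrite /df indicE.
have [s0|s0] := ltP 0 (4 - t ^+ 2 * sqnorm x); last first.
  rewrite !(flat_exp_le0 _ s0) !(mulr0, subr0, mul0r) normr0.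
  by rewrite !mulr_ge0 ?addr_ge0 ?mulr_ge0 ?flat_exp_ub_ge0.
have s16 := supp t0 s0.
have x4 := sqnorm_cube (ler0n _ 4) s16.
rewrite mem_set// mulr1 normrM ler_pM ?FB// normrM ler_pM//.
  apply: le_trans (ler_normB _ _) _; rewrite normrM (ger0_norm (ler0n _ 2)).
  by rewrite lerD ?ler_wpM2l ?norm_flat_exp// gerBl t2_sqnorm.
have q0 := sqnorm_ge0 x; rewrite normrN ger0_norm; nra.
Qed.

Let integral_f (t : R) : 1 / 2 < t ->
  \int[lam]_x f t x = t^-1 ^+ (n + d) * \int[lam]_x f 1 x.
Proof.
move=> th; have t0 : 0 < t by apply: lt_trans th; rewrite divr_gt0.
rewrite [in RHS](@Rintegral_scale _ _ t)//; last by apply: intf; lra.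
transitivity (t^-1 ^+ (n + d) * (t ^+ n * (t ^+ d * \int[lam]_x f t x))).
  rewrite (mulrA (t ^+ n)) -exprD mulrA -exprMn.
  by rewrite mulVf ?expr1n ?mul1r// lt0r_neq0.
congr (_ * (_ * _)).
rewrite -RintegralZl//; last exact: intf.
apply: eq_Rintegral => x _.
by rewrite /f homF// sqnormZ expr1n mul1r mulrA.
Qed.

(* Both sides are -1/2 times the derivative at t = 1 of \int f t, which equals
   t^-(n+d) \int f 1 by scaling. *)
Lemma euler_identity :
  \int[lam]_x (F x * (sqnorm x *
    (flat_exp 4 (4 - sqnorm x) - 2 * flat_exp 3 (4 - sqnorm x)))) =
  (n + d)%:R / 2 * \int[lam]_x (F x * flat_exp 2 (4 - sqnorm x)).
Proof.
have I1 : `](1 / 2 : R), 2[%classic 1 by rewrite /= in_itv/=; lra.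
pose G x := ub * \1_(cube 0 4) x.
have G0 x : 0 <= G x.
  by rewrite !mulr_ge0 ?addr_ge0 ?mulr_ge0 ?flat_exp_ub_ge0.
have intG : lam.-integrable setT (EFin \o G).
  have [|//||||//] := @integrable_cube R n G ub 4.
  - by rewrite !mulr_ge0 ?addr_ge0 ?mulr_ge0 ?flat_exp_ub_ge0.
  - apply: measurable_funM => //.
    by apply: measurable_indic; exact: measurable_cube.
  - move=> x x4; rewrite ger0_norm// /G indicE mem_set// mulr1//.
  - move=> x; rewrite /G indicE; case: (boolP (x \in _)); first by rewrite inE.
    by rewrite mulr0 eqxx.
have dfE t x : partial1of2 f t x = df t x.
  by rewrite partial1of2E; have [_ ->] := is_derive_f t x.
have := @differentiation_under_integral R _ _ lam f setT measurableT 1 (1/2) 2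
  I1 _ _ G G0 intG _.
rewrite derive1E => /(_ _ _ _)/esym.
move=> H.
have {}H : \int[lam]_x df 1 x = 'D_1 (fun t => \int[lam]_x f t x) 1.
  under eq_Rintegral do rewrite -dfE.
  apply: H.
  - by move=> t; rewrite /= in_itv/= => /andP[t0 _]; exact: intf.
  - by move=> t x _ _; have [] := is_derive_f t x.
  - move=> t x; rewrite /= in_itv/= => /andP[t0 t2] _; rewrite dfE; exact: df_ub.
have D : is_derive (1 : R) 1 (fun t => \int[lam]_x f t x)
    (- (n + d)%:R * \int[lam]_x f 1 x).
  apply: (@near_eq_is_derive R R R
      (fun t : R => t^-1 ^+ (n + d) * \int[lam]_x f 1 x)).
    have h1 : 1 / 2 < 1 :> R by lra.
    near=> t; apply/esym/integral_f; near: t; exact: (lt_nbhsr h1).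
  have dV : is_derive (1 : R) 1 (@GRing.inv R) (-1).
    have n1 : (1 : R) != 0 by exact: oner_neq0.
    apply: DeriveDef; first exact: (@derivableV _ _ id).
    by rewrite (@deriveV _ _ id)// derive_id [_ *: _]mulr1 expr1n invr1.
  have := is_deriveZ (\int[lam]_x f 1 x) (is_deriveX (n + d) dV).
  rewrite [X in is_derive _ _ X _ -> _](_ : _ =
      fun t : R => t^-1 ^+ (n + d) * \int[lam]_x f 1 x).
    move=> /is_derive_eq; apply.
    by rewrite /GRing.scale/= invr1 expr1n mulr1 mulrN1 mulrC.
  by apply/funext => t; rewrite /= !fctE /GRing.scale/= mulrC.
move: H; rewrite derive_val => H.
have fE x : f 1 x = F x * flat_exp 2 (4 - sqnorm x).
  by rewrite /f expr1n mul1r.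
under [in RHS]eq_Rintegral do rewrite -fE.
have -> : (n + d)%:R / 2 * \int[lam]_x f 1 x = - (2^-1) * \int[lam]_x df 1 x.
  by rewrite H; ring.
rewrite -RintegralZl//; last first.
  apply: (le_integrable measurableT _ _ intG).
    apply/measurable_EFinP; apply: measurable_funM => //.
    apply: measurable_funM.
      apply: measurable_funB; first exact: measurable_flat_exp_sqnorm.
      by apply: measurable_funM => //; exact: measurable_flat_exp_sqnorm.
    apply: measurableT_comp => //; apply: measurable_funM => //.
    by apply: continuous_measurable_rV; exact: continuous_sqnorm.
  move=> x _; rewrite lee_fin/= [leRHS]ger0_norm//; apply: df_ub; lra.
by apply: eq_Rintegral => x _; rewrite /df expr1n mul1r; field.
Unshelve. all: by end_near. Qed.

End homogeneous_weight.

(** * Bounds for lower and upper limits along a filter *)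

Section limits.
Context {R : realType}.
Local Open Scope ereal_scope.

Lemma limf_einf_le_esup (f : R -> \bar R) (F : set_system R) :
  ProperFilter F -> limf_einf f F <= limf_esup f F.
Proof.
move=> FF; rewrite limf_einfE limf_esupE.
apply: ge_ereal_sup => _ [A FA <-]; apply: le_ereal_inf_tmp => _ [B FB <-].
have [x [Ax Bx]] := filter_ex (filterI FA FB).
apply: (@le_trans _ _ (f x)); first by apply: ereal_inf_lbound; exists x.
by apply: ereal_sup_ubound; exists x.
Qed.

Lemma limf_einf_ge (f : R -> \bar R) (F : set_system R) c :
  F [set x | c <= f x] -> c <= limf_einf f F.
Proof.
move=> Fc; rewrite limf_einfE; apply: le_ereal_sup_tmp.
exists (ereal_inf [set f x | x in [set x | c <= f x]]); first by exists [set x | c <= f x].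
by apply: le_ereal_inf_tmp => _ [x ? <-].
Qed.

Lemma limf_esup_le (f : R -> \bar R) (F : set_system R) c :
  F [set x | f x <= c] -> limf_esup f F <= c.
Proof.
move=> Fc; rewrite limf_esupE; apply: ge_ereal_inf.
exists (ereal_sup [set f x | x in [set x | f x <= c]]); first by exists [set x | f x <= c].
by apply: ge_ereal_sup => _ [x ? <-].
Qed.

End limits.

(** * The cutoff at scale r and the pairing with its Laplacian *)

Section cutoff_function.
Context {R : realType} {n : nat}.
Implicit Types (f F : 'rV[R]_n -> R) (x : 'rV[R]_n).
Local Notation lam := (@lebesgue_rV R n).

Lemma euclidean_cballE (r : R) : 0 <= r ->
  euclidean_cball r = [set x : 'rV[R]_n | sqnorm x <= r ^+ 2].
Proof.
move=> r0; apply/seteqP; split=> x; rewrite /euclidean_cball/= -/(sqnorm x).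
  by move=> xr; rewrite -(sqr_sqrtr (sqnorm_ge0 x)) lerXn2r ?nnegrE ?sqrtr_ge0.
by move=> xr; rewrite -(ger0_norm r0) -sqrtr_sqr ler_wsqrtr.
Qed.

Lemma closed_euclidean_cball (r : R) : 0 <= r -> closed (@euclidean_cball R n r).
Proof.
move=> r0; rewrite euclidean_cballE//.
apply: (@closed_comp _ _ sqnorm [set t : R | t <= r ^+ 2]).
  by move=> x _; exact: continuous_sqnorm.
exact: closed_le.
Qed.

Lemma compact_euclidean_cball (r : R) : 0 <= r -> compact (@euclidean_cball R n r).
Proof.
move=> r0; apply: bounded_closed_compact; last exact: closed_euclidean_cball.
exists r; split; first exact: num_real.
move=> s rs x; rewrite euclidean_cballE// => /(sqnorm_cube r0) xr.
rewrite /= [leLHS]/Num.norm/= mx_normrE.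
apply: bigmax_le; first exact: (le_trans r0 (ltW rs)).
move=> [i j] _ /=; rewrite ord1; apply: le_trans (ltW rs).
by have := xr j; rewrite mxE sub0r normrN.
Qed.

Lemma measurable_euclidean_cball (r : R) : 0 <= r ->
  measurable (@euclidean_cball R n r).
Proof.
move=> r0; rewrite -(setCK (euclidean_cball r)); apply: measurableC.
apply: sub_sigma_algebra; rewrite /= openC; exact: closed_euclidean_cball.
Qed.

(** The argument is positive exactly for |x| < 2r and at least 3 on B_r, whence the lower bound
    [flat_exp 0 3] there; values of exp(-1/s) never exceed 1. *)
Definition cutoff (r : R) x : R := flat_exp 0 (4 - r ^- 2 * sqnorm x).

Lemma cutoff_support (r : R) x : 0 < r -> 0 < 4 - r ^- 2 * sqnorm x ->
  sqnorm x <= (2 * r) ^+ 2.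
Proof.
move=> r0; rewrite subr_gt0 mulrC ltr_pdivrMr ?exprn_gt0// => /ltW.
by rewrite exprMn -natrX.
Qed.

Lemma test_function_cutoff (r : R) : 0 < r -> test_function (cutoff r).
Proof.
move=> r0; have r20 : 0 <= 2 * r by rewrite mulr_ge0// ltW.
split; first exact: cutoff_alg_smooth (CutoffBump _ _ _).
apply: (subclosed_compact _ (compact_euclidean_cball r20)).
  exact: closed_closure.
rewrite [X in _ `<=` X](closure_id _).1; last exact: closed_euclidean_cball.
apply: closure_subset => x /= xn0; rewrite euclidean_cballE//=.
apply: cutoff_support => //; rewrite ltNge; apply: contra xn0.
by move=> /flat_exp_le0 h; rewrite /cutoff h.
Qed.

Lemma cutoff_le_indic (r : R) x : 0 < r ->
  cutoff r x <= \1_(euclidean_cball (2 * r)) x.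
Proof.
move=> r0; have r20 : 0 <= 2 * r by rewrite mulr_ge0// ltW.
rewrite indicE euclidean_cballE//.
have [h|h] := ltP 0 (4 - r ^- 2 * sqnorm x); last by rewrite /cutoff flat_exp_le0.
rewrite mem_set; last exact: cutoff_support.
rewrite /cutoff /flat_exp h expr0 mul1r expR_le1 oppr_le0 invr_ge0; exact: ltW.
Qed.

Lemma indic_le_cutoff (r : R) x : 0 < r ->
  flat_exp 0 3 * \1_(euclidean_cball r) x <= cutoff r x.
Proof.
move=> r0; rewrite indicE (euclidean_cballE (ltW r0)).
have [/set_mem/= h|_] := boolP (x \in _); last by rewrite mulr0 flat_exp_ge0.
have h3 : 3 <= 4 - r ^- 2 * sqnorm x.
  have : r ^- 2 * sqnorm x <= 1.
    by rewrite mulrC ler_pdivrMr ?mul1r// exprn_gt0.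
  lra.
have h0 : 0 < 4 - r ^- 2 * sqnorm x by lra.
rewrite mulr1 /cutoff /flat_exp h0 ltr0n !expr0 !mul1r ler_expR lerN2.
by rewrite lef_pV2 ?posrE.
Qed.

(** A termwise bound of the Laplacian formula without its factor r^-2; 16 bounds 4 |x|^2 / r^2 on
    the support. *)
Definition lap_ub : R :=
  16 * (flat_exp_ub 4 + 2 * flat_exp_ub 3) + 2 * n%:R * flat_exp_ub 2.

Lemma lap_ub_ge0 : 0 <= lap_ub.
Proof. by rewrite !(addr_ge0, mulr_ge0, flat_exp_ub_ge0). Qed.

Lemma laplacian_cutoffZ (r : R) x : 0 < r ->
  laplacian (cutoff r) (r *: x) = r ^- 2 * laplacian (cutoff 1) x.
Proof.
move=> r0; rewrite !laplacian_flat_exp sqnormZ expr1n invr1 !mul1r.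
by rewrite mulKf// expf_neq0// gt_eqF.
Qed.

Lemma laplacian_cutoff_eq0 (r : R) x : 4 - r ^- 2 * sqnorm x <= 0 ->
  laplacian (cutoff r) x = 0.
Proof.
by move=> h; rewrite laplacian_flat_exp !flat_exp_le0// !(mulr0, subr0).
Qed.

Lemma laplacian_cutoff_le (r : R) x : 0 < r ->
  `|laplacian (cutoff r) x| <= r ^- 2 * lap_ub.
Proof.
move=> r0; have a0 : 0 <= r ^- 2 by rewrite invr_ge0 exprn_ge0// ltW.
have [h|/laplacian_cutoff_eq0 ->] := ltP 0 (4 - r ^- 2 * sqnorm x); last first.
  by rewrite normr0 mulr_ge0 ?lap_ub_ge0.
rewrite laplacian_flat_exp normrM ger0_norm// ler_wpM2l//.
have q0 : 0 <= r ^- 2 * sqnorm x by rewrite mulr_ge0 ?sqnorm_ge0.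
have h4 : 4 - r ^- 2 * sqnorm x <= 4 by rewrite gerBl.
apply: le_trans (ler_normB _ _) _; rewrite lerD// normrM.
  rewrite ler_pM//; first by rewrite ger0_norm; lra.
  apply: le_trans (ler_normB _ _) _; rewrite normrM (ger0_norm (ler0n _ 2)).
  by rewrite lerD ?ler_wpM2l ?norm_flat_exp.
by rewrite ger0_norm ?mulr_ge0// ler_wpM2l ?mulr_ge0// norm_flat_exp.
Qed.

Lemma laplacian_cutoff_support (r : R) x : 0 < r ->
  laplacian (cutoff r) x != 0 -> cube 0 (2 * r) x.
Proof.
move=> r0 h; apply: sqnorm_cube; first by rewrite mulr_ge0// ltW.
apply: cutoff_support => //; rewrite ltNge; apply: contra h.
by move=> /laplacian_cutoff_eq0 ->.
Qed.

Lemma measurable_laplacian_cutoff (r : R) :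
  measurable_fun setT (laplacian (cutoff r)).
Proof.
rewrite (_ : laplacian _ = fun x => r ^- 2 * (4 * (r ^- 2 * sqnorm x) *
         (flat_exp 4 (4 - r ^- 2 * sqnorm x) -
          2 * flat_exp 3 (4 - r ^- 2 * sqnorm x)) -
       2 * n%:R * flat_exp 2 (4 - r ^- 2 * sqnorm x))); last first.
  by apply/funext => x; rewrite laplacian_flat_exp.
have mq : measurable_fun setT (@sqnorm R n).
  by apply: continuous_measurable_rV; exact: continuous_sqnorm.
have mg k := @measurable_flat_exp_sqnorm R n k (r ^- 2) 4.
apply: measurable_funM => //; apply: measurable_funB; last exact: measurable_funM.
apply: measurable_funM; last by apply: measurable_funB => //; exact: measurable_funM.
by apply: measurable_funM => //; exact: measurable_funM.
Qed.

(** For [f] equal to h^+ or h^- this is the q(r) of the overview; [integral_gt0_domain] reconciles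
    the domains of integration. *)
Definition pairing f (r : R) : R := \int[lam]_x (f x * laplacian (cutoff r) x).

Lemma pairing_bound f (r M : R) : 0 < r -> 0 <= M -> measurable_fun setT f ->
  (forall x, cube 0 (2 * r) x -> `|f x| <= M) ->
  lam.-integrable setT (EFin \o (fun x => f x * laplacian (cutoff r) x)) /\
  `|pairing f r| <= M * (r ^- 2 * lap_ub) * (2 * (2 * r)) ^+ n.
Proof.
move=> r0 M0 mf fM; apply: integrable_cube.
- by rewrite !mulr_ge0 ?lap_ub_ge0// invr_ge0 exprn_ge0// ltW.
- by rewrite mulr_ge0// ltW.
- by apply: measurable_funM => //; exact: measurable_laplacian_cutoff.
- by move=> x /fM fx; rewrite normrM ler_pM// laplacian_cutoff_le.
- move=> x; rewrite mulf_eq0 negb_or => /andP[_].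
  exact: laplacian_cutoff_support.
Qed.

End cutoff_function.

(** * Growth of the pairing for homogeneous and nearly homogeneous functions *)

Section asymptotics.
Context {R : realType} {n : nat}.
Implicit Types (f F : 'rV[R]_n -> R) (x : 'rV[R]_n).
Local Notation lam := (@lebesgue_rV R n).

Definition cube_bounded F d (M : R) := forall r x, 1 <= r -> cube 0 r x ->
  `|F x| <= M * r ^+ d.

Lemma pairing_cube_bounded F d (M r : R) : 1 <= r -> 0 <= M ->
  measurable_fun setT F -> cube_bounded F d M ->
  lam.-integrable setT (EFin \o (fun x => F x * laplacian (cutoff r) x)) /\
  `|pairing F r| <= M * (2 * r) ^+ d * (r ^- 2 * @lap_ub R n) * (2 * (2 * r)) ^+ n.
Proof.
move=> r1 M0 mF FM; have r0 : 0 < r by exact: lt_le_trans r1.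
have r20 : 0 <= 2 * r by rewrite mulr_ge0// ltW.
apply: pairing_bound => //; first by rewrite mulr_ge0 ?exprn_ge0.
by move=> x xr; apply: FM => //; lra.
Qed.

(** Substituting [r *: x] yields r^n from the measure, r^d from [F] and r^-2 from the Laplacian. A
    quotient of powers avoids truncated subtraction in n + d - 2. *)
Lemma pairing_homog F d (M r : R) : 1 <= r -> 0 <= M ->
  measurable_fun setT F -> cube_bounded F d M ->
  (forall t x, 0 < t -> F (t *: x) = t ^+ d * F x) ->
  pairing F r = r ^+ (n + d) / r ^+ 2 * pairing F 1.
Proof.
move=> r1 M0 mF FM homF; have r0 : 0 < r by exact: lt_le_trans r1.
have [int1 _] := pairing_cube_bounded (lexx 1) M0 mF FM.
have [intr _] := pairing_cube_bounded r1 M0 mF FM.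
have -> : pairing F r =
    r ^+ n * \int[lam]_x (F (r *: x) * laplacian (cutoff r) (r *: x)).
  exact: (Rintegral_scale r0 intr).
rewrite exprD -mulrA -mulrA; congr (_ * _).
rewrite mulrA -[RHS](RintegralZl _ measurableT int1).
apply: eq_Rintegral => x _.
by rewrite homF// laplacian_cutoffZ// mulrACA.
Qed.

Lemma integrable_weight F (M : R) : 0 <= M -> measurable_fun setT F ->
  (forall x, cube 0 4 x -> `|F x| <= M) ->
  lam.-integrable setT (EFin \o (fun x => F x * flat_exp 2 (4 - sqnorm x))).
Proof.
move=> M0 mF FM.
have mg : measurable_fun setT (fun x => flat_exp 2 (4 - sqnorm x)).
  have := @measurable_flat_exp_sqnorm R n 2 1 4.
  by under eq_fun do rewrite mul1r.
have [|//||||//] := @integrable_cube R n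
  (fun x => F x * flat_exp 2 (4 - sqnorm x)) (M * flat_exp_ub 2) 4.
- by rewrite mulr_ge0 ?flat_exp_ub_ge0.
- exact: measurable_funM.
- move=> x x4; rewrite normrM ler_pM ?FM// norm_flat_exp//.
  by rewrite gerBl sqnorm_ge0.
- move=> x; rewrite mulf_eq0 negb_or => /andP[_ g0].
  apply: sqnorm_cube => //.
  have : 0 < 4 - sqnorm x.
    by rewrite ltNge; apply: contra g0 => /flat_exp_le0 ->.
  by lra.
Qed.

(** The Laplacian formula expresses the integral of F |x|^2 g'' through the pairing and the integral
    of F g'; comparison with [euler_identity] gives the coefficient 2 (n + d) - 2 n = 2 d. *)
Lemma pairing_cutoff1 F d (M : R) : 0 <= M ->
  measurable_fun setT F -> cube_bounded F d M ->
  (forall t x, 0 < t -> F (t *: x) = t ^+ d * F x) ->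
  pairing F 1 = 2 * d%:R * \int[lam]_x (F x * flat_exp 2 (4 - sqnorm x)).
Proof.
move=> M0 mF FM homF.
have FM4 x : cube 0 4 x -> `|F x| <= M * 4 ^+ d by move=> /FM; apply; lra.
have M40 : 0 <= M * 4 ^+ d by rewrite mulr_ge0 ?exprn_ge0.
have [int1 _] := pairing_cube_bounded (lexx 1) M0 mF FM.
have intw := integrable_weight M40 mF FM4.
have := euler_identity mF homF M40 FM4.
set K := \int[lam]_x (F x * flat_exp 2 _).
have -> : \int[lam]_x (F x * (sqnorm x *
    (flat_exp 4 (4 - sqnorm x) - 2 * flat_exp 3 (4 - sqnorm x)))) =
    4^-1 * (pairing F 1 + 2 * n%:R * K).
  have intw2 : lam.-integrable setT
      (EFin \o (fun x => 2 * n%:R * (F x * flat_exp 2 (4 - sqnorm x)))).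
    exact: (integrableZl measurableT (2 * n%:R) intw).
  have ints : lam.-integrable setT (EFin \o (fun x =>
      F x * laplacian (cutoff 1) x +
      2 * n%:R * (F x * flat_exp 2 (4 - sqnorm x)))).
    exact: (integrableD measurableT int1 intw2).
  rewrite /K -(RintegralZl _ measurableT intw) -(RintegralD measurableT int1 intw2).
  rewrite -[RHS](RintegralZl _ measurableT ints).
  apply: eq_Rintegral => x _.
  by rewrite laplacian_flat_exp expr1n invr1 !mul1r; field.
rewrite natrD; lra.
Qed.

(** The pairing is linear, and [f - F] grows with exponent [k] instead of [k.+1], which gains the
    factor 1/r. The equation on [e] encodes e = n + (k+1) - 2 without truncation. *)
Lemma pairing_asymptotics f F k e (M : R) : 0 <= M -> (e.+2 = n + k.+1)%N ->
  measurable_fun setT f -> measurable_fun setT F ->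
  cube_bounded (fun x => f x - F x) k M -> cube_bounded F k.+1 M ->
  (forall t x, 0 < t -> F (t *: x) = t ^+ k.+1 * F x) ->
  exists A, forall r, 1 <= r ->
    `|pairing f r - r ^+ e * pairing F 1| <= A * (r ^+ e / r).
Proof.
move=> M0 en mf mF fFM FM homF.
exists (M * 2 ^+ k * @lap_ub R n * 4 ^+ n) => r r1.
have r0 : 0 < r by exact: lt_le_trans r1.
have [intF _] := pairing_cube_bounded r1 M0 mF FM.
have mfF : measurable_fun setT (fun x => f x - F x) by exact: measurable_funB.
have [intfF bnd] := pairing_cube_bounded r1 M0 mfF fFM.
have -> : r ^+ e * pairing F 1 = pairing F r.
  rewrite (pairing_homog r1 M0 mF FM homF) -en -(addn2 e) exprD mulfK//.
  by rewrite expf_neq0// gt_eqF.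
have -> : pairing f r - pairing F r = pairing (fun x => f x - F x) r.
  apply/eqP; rewrite subr_eq; apply/eqP; rewrite /pairing -RintegralD//.
  by apply: eq_Rintegral => x _; rewrite -mulrDl subrK.
apply: le_trans bnd _; rewrite le_eqVlt; apply/orP; left; apply/eqP.
have er : r ^+ e * r = r ^+ k * r ^+ n.
  by rewrite -exprSr -exprD addnC; congr (_ ^+ _); lia.
have rn0 : r != 0 by rewrite gt_eqF.
rewrite mulrA (_ : 2 * 2 = 4); last by ring.
rewrite !exprMn -[r ^+ e](mulfK rn0) er; field.
exact: rn0.
Qed.

End asymptotics.

(** * From growth of the cutoff integrals to ratios of masses *)

Section doubling.
Context {R : realType}.

(** From q(s/2) <= m(s) <= q(s)/c, both ends are comparable to P s^e. Halving the radius costs 2^e,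
    the quotient of 4/3 by 2/3 costs 2, and [P] cancels: this is the constant 2^(e+1) / c. *)
Lemma doubling_ratio (m q : R -> R) (c P r1 tau : R) (e : nat) :
  0 < c -> 0 < P ->
  (forall r, 0 < r -> c * m r <= q r <= m (2 * r)) ->
  (forall r, r1 <= r -> 0 < r ->
    2 / 3 * P * r ^+ e <= q r <= 4 / 3 * P * r ^+ e) ->
  1 < tau -> forall r, 0 < r -> 2 * r1 <= r ->
  0 < m r /\
  tau ^+ e / (2 ^+ e.+1 / c) <= m (tau * r) / m r <= 2 ^+ e.+1 / c * tau ^+ e.
Proof.
move=> c0 P0 mq qP tau1 r r0 r1r.
have tau0 : 0 < tau by exact: lt_trans tau1.
have re0 : 0 < r ^+ e by rewrite exprn_gt0.
have te0 : 0 < tau ^+ e by rewrite exprn_gt0.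
have e20 : 0 < (2 : R) ^+ e by rewrite exprn_gt0.
(* The lower bound evaluates [q] at [s / 2], hence the threshold [2 * r1]. *)
have mlow s : 0 < s -> 2 * r1 <= s -> 2 / 3 * P * (s ^+ e / 2 ^+ e) <= m s.
  move=> s0 s1; have s20 : 0 < s / 2 by rewrite divr_gt0.
  have /andP[_] := mq _ s20; rewrite (_ : 2 * (s / 2) = s); last by field.
  apply: le_trans; have /andP[+ _] : 2 / 3 * P * (s / 2) ^+ e <= q (s / 2) <=
      4 / 3 * P * (s / 2) ^+ e by apply: qP => //; lra.
  by rewrite expr_div_n.
have mupp s : 0 < s -> r1 <= s -> m s <= 4 / 3 * P * s ^+ e / c.
  move=> s0 s1; rewrite ler_pdivlMr// mulrC.
  by have /andP[h _] := mq _ s0; have /andP[_] := qP _ s1 s0; exact: le_trans.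
have r1r' : r1 <= r by lra.
have tr0 : 0 < tau * r by rewrite mulr_gt0.
have tr : r <= tau * r by rewrite ler_peMl// ltW.
have mr0 : 0 < m r.
  by apply: lt_le_trans (mlow _ r0 r1r); rewrite !mulr_gt0 ?invr_gt0.
split=> //; rewrite ler_pdivlMr// ler_pdivrMr//; apply/andP; split.
  apply: le_trans (mlow _ tr0 (le_trans r1r tr)).
  apply: (@le_trans _ _ (tau ^+ e / (2 ^+ e.+1 / c) * (4 / 3 * P * r ^+ e / c))).
    apply: ler_wpM2l (mupp _ r0 r1r').
    by apply/ltW; rewrite !divr_gt0 ?exprn_gt0.
  rewrite le_eqVlt exprMn exprS; apply/orP; left; apply/eqP; field.
  by rewrite !gt_eqF.
apply: le_trans (mupp _ tr0 (le_trans r1r' tr)) _.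
apply: (@le_trans _ _ (2 ^+ e.+1 / c * tau ^+ e * (2 / 3 * P * (r ^+ e / 2 ^+ e)))).
  rewrite le_eqVlt exprMn exprS; apply/orP; left; apply/eqP; field.
  by rewrite !gt_eqF.
apply: ler_wpM2l (mlow _ r0 r1r).
by apply/ltW; rewrite mulr_gt0 ?divr_gt0 ?exprn_gt0.
Qed.

End doubling.

(** * Uniqueness of the leading growth coefficient *)

Section growth_coefficient.
Context {R : realType}.

(** Dividing by r^e gives |P - P'| <= (A + A') / r. *)
Lemma growth_coefficient_unique (q : R -> R) (P P' A A' : R) e :
  (forall r, 1 <= r -> `|q r - r ^+ e * P| <= A * (r ^+ e / r)) ->
  (forall r, 1 <= r -> `|q r - r ^+ e * P'| <= A' * (r ^+ e / r)) ->
  P = P'.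
Proof.
move=> qP qP'; apply/eqP; rewrite -subr_eq0 -normr_eq0.
set D := `|_|; apply/negPn/negP => D0.
have {}D0 : 0 < D by rewrite lt_def D0 normr_ge0.
(* With this choice r D = D + |A + A'| > A + A', contradicting the inequality. *)
pose r := 1 + `|A + A'| / D.
have r1 : 1 <= r by rewrite lerDl divr_ge0// ltW.
have r0 : 0 < r by exact: lt_le_trans r1.
have re : 0 < r ^+ e by rewrite exprn_gt0.
have : r ^+ e * D <= (A + A') * (r ^+ e / r).
  rewrite /D -{1}(ger0_norm (ltW re)) -normrM mulrDl.
  have -> : r ^+ e * (P - P') = (q r - r ^+ e * P') - (q r - r ^+ e * P).
    by ring.
  by apply: le_trans (ler_normB _ _) _; rewrite addrC lerD ?qP ?qP'.
rewrite mulrCA ler_pM2l// ler_pdivlMr//.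
rewrite /r mulrDr mulr1 mulrCA divff ?gt_eqF// mulr1.
have := ler_norm (A + A'); lra.
Qed.

End growth_coefficient.

(** * Growth of the cutoff integrals against harmonic measure *)

Section harmonic_measure_growth.
Context {R : realType} {n : nat}.
Implicit Types (h H : 'rV[R]_n -> R) (x : 'rV[R]_n).
Implicit Types omega : {measure set 'rV[R]_n -> \bar R}.
Local Notation lam := (@lebesgue_rV R n).

Lemma cutoff_integral_bounds omega (r : R) : 0 < r ->
  ((flat_exp 0 3)%:E * omega (euclidean_cball r) <=
     \int[omega]_x (cutoff r x)%:E <= omega (euclidean_cball (2 * r)))%E.
Proof.
move=> r0; have r20 : 0 <= 2 * r by rewrite mulr_ge0// ltW.
have mB (s : R) : 0 <= s -> measurable_fun setT
    (\1_(euclidean_cball s) : 'rV[R]_n -> R).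
  by move=> s0; apply: measurable_indic; exact: measurable_euclidean_cball.
have mc : measurable_fun setT (fun x => (cutoff r x)%:E).
  by apply/measurable_EFinP; exact: measurable_flat_exp_sqnorm.
apply/andP; split.
  rewrite -(setIT (euclidean_cball r)) -integral_indic//; last first.
    by apply: measurable_euclidean_cball; exact: ltW.
  rewrite -ge0_integralZl//; last 2 first.
  - by apply/measurable_EFinP; apply: mB; exact: ltW.
  - by rewrite lee_fin flat_exp_ge0.
  apply: ge0_le_integral => //.
  - by move=> x _; rewrite -EFinM lee_fin mulr_ge0// flat_exp_ge0.
  - under eq_fun do rewrite -EFinM.
    by apply/measurable_EFinP; apply: measurable_funM => //; apply: mB; exact: ltW.
  - by move=> x _; rewrite -EFinM lee_fin indic_le_cutoff.
rewrite -(setIT (euclidean_cball (2 * r))) -integral_indic//; last first.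
  exact: measurable_euclidean_cball.
apply: ge0_le_integral => //.
- by move=> x _; rewrite lee_fin flat_exp_ge0.
- by apply/measurable_EFinP; apply: mB.
- by move=> x _; rewrite lee_fin cutoff_le_indic.
Qed.

Lemma integral_gt0_domain (f g : 'rV[R]_n -> R) : (forall x, 0 <= f x) ->
  (\int[lam]_(x in [set x | (0 < f x)%R]) (f x * g x)%:E =
   \int[lam]_x (f x * g x)%:E)%E.
Proof.
move=> f0; rewrite integral_mkcond; apply: eq_integral => x _.
rewrite patchE; case: (boolP (x \in _)) => // /negP xf.
suff -> : f x = 0 by rewrite mul0r.
apply/eqP; rewrite eq_le f0 andbT leNgt; apply/negP => fx.
by apply: xf; rewrite inE.
Qed.

(** Taking positive parts is 1-Lipschitz and commutes with positive scaling, so the bounds and the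
    homogeneity pass from h and H to h^+ and H^+. Applied to -h and -H, the lemma covers the
    negative parts. *)
Lemma funrpos_asymptotics h H k e (M : R) : 0 <= M -> (e.+2 = n + k.+1)%N ->
  continuous h -> continuous H ->
  (forall r x, 1 <= r -> cube 0 r x ->
    `|h x - H x| <= M * r ^+ k /\ `|H x| <= M * r ^+ k.+1) ->
  (forall t x, H (t *: x) = t ^+ k.+1 * H x) ->
  [/\ exists A, forall r, 1 <= r ->
        lam.-integrable setT
          (EFin \o (fun x => h^\+ x * laplacian (cutoff r) x)) /\
        `|pairing h^\+ r - r ^+ e * pairing H^\+ 1| <= A * (r ^+ e / r),
      lam.-integrable setT
        (EFin \o (fun x => H^\+ x * flat_exp 2 (4 - sqnorm x)))
    & pairing H^\+ 1 =
        2 * k.+1%:R * \int[lam]_x (H^\+ x * flat_exp 2 (4 - sqnorm x))].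
Proof.
move=> M0 en ch cH hM homH.
have mh : measurable_fun setT h^\+.
  by apply: measurable_funrpos; exact: continuous_measurable_rV.
have mH : measurable_fun setT H^\+.
  by apply: measurable_funrpos; exact: continuous_measurable_rV.
have lip a b : `|Num.max a 0 - Num.max b 0| <= `|a - b| :> R.
  have := ler_norm (a - b); have := ler_norm (b - a); rewrite (distrC b a).
  have := normr_ge0 (a - b).
  by rewrite ler_norml; case: (leP a 0); case: (leP b 0); lra.
have hHM : cube_bounded (fun x => h^\+ x - H^\+ x) k M.
  by move=> r x r1 xr; apply: le_trans (lip _ _) _; have [] := hM r x r1 xr.
have HM : cube_bounded H^\+ k.+1 M.
  move=> r x r1 xr; have [_] := hM r x r1 xr; apply: le_trans.
  by have := lip (H x) 0; rewrite maxxx !subr0.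
have homHp t x : 0 < t -> H^\+ (t *: x) = t ^+ k.+1 * H^\+ x.
  by move=> t0; rewrite /funrpos homH maxr_pMr ?mulr0// exprn_ge0// ltW.
split.
- have [A hA] := pairing_asymptotics M0 en mh mH hHM HM homHp.
  exists A => r r1; split; last exact: hA.
  (* This cruder growth bound serves only to make the pairing integrand of [h^\+] integrable. *)
  have hb : cube_bounded h^\+ k.+1 (2 * M).
    move=> s x s1 xs; rewrite -[h^\+ x](subrK (H^\+ x)).
    apply: le_trans (ler_normD _ _) _.
    have := HM _ _ s1 xs; have := hHM _ _ s1 xs.
    have : M * s ^+ k <= M * s ^+ k.+1 by rewrite ler_wpM2l// ler_weXn2l.
    lra.
  by have [] := pairing_cube_bounded r1 (mulr_ge0 (ler0n _ 2) M0) mh hb.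
- apply: (@integrable_weight _ _ _ (M * 4 ^+ k.+1)) => //.
    by rewrite mulr_ge0 ?exprn_ge0.
  by move=> x; apply: HM; lra.
- exact: pairing_cutoff1 HM homHp.
Qed.

(** By homogeneity a point where [H] is nonzero can be shrunk into the ball |x| < 2, where the
    weight is positive. The factor t = 1 / (1 + |y|^2) does so, as t^2 |y|^2 < 4. *)
Lemma integral_norm_homog_gt0 H : continuous H -> (exists x, H x != 0) ->
  forall d, (forall t x, H (t *: x) = t ^+ d * H x) ->
  (0 < \int[lam]_x (`|H x| * flat_exp 2 (4 - sqnorm x))%:E)%E.
Proof.
move=> cH [y Hy] d homH; pose t := (1 + sqnorm y)^-1.
have q0 := sqnorm_ge0 y.
have t0 : 0 < t by rewrite invr_gt0; lra.
apply: (@integral_continuous_gt0 _ _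
  (fun x => `|H x| * flat_exp 2 (4 - sqnorm x)) (t *: y)).
- move=> x; apply: (@continuousM _ _ (fun x => `|H x|)
    (fun x => flat_exp 2 (4 - sqnorm x))).
    apply: (@continuous_comp _ _ _ H (fun s => `|s|)); first exact: cH.
    exact: norm_continuous.
  have := @continuous_flat_exp_sqnorm R n 2 1 4.
  by under eq_fun do rewrite mul1r; exact.
- by move=> x; rewrite mulr_ge0// flat_exp_ge0.
- apply: mulr_gt0; first by rewrite normr_gt0 homH mulf_neq0// expf_neq0 ?gt_eqF.
  apply: flat_exp_gt0; rewrite sqnormZ subr_gt0.
  rewrite /t exprVn mulrC ltr_pdivrMr ?exprn_gt0//; nra.
Qed.

Lemma cutoff_integral_growth h omega e k H (M : R) :
  0 <= M -> (e.+2 = n + k.+1)%N ->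
  continuous h -> continuous H -> (exists x, H x != 0) ->
  (forall r x, 1 <= r -> cube 0 r x ->
    `|h x - H x| <= M * r ^+ k /\ `|H x| <= M * r ^+ k.+1) ->
  (forall t x, H (t *: x) = t ^+ k.+1 * H x) ->
  harmonic_measure h omega ->
  exists A P, 0 < P /\ forall r, 1 <= r ->
    exists2 q, (\int[omega]_x (cutoff r x)%:E)%E = q%:E &
      `|q - r ^+ e * P| <= A * (r ^+ e / r).
Proof.
move=> M0 en ch cH Hn0 hM homH [_ _ hom].
have [[A hA] intp Pp] := funrpos_asymptotics M0 en ch cH hM homH.
have [||||[A' hA'] intn Pn] :=
  @funrpos_asymptotics (\- h) (\- H) k e M M0 en.
- by move=> x; apply: continuousN; exact: ch.
- by move=> x; apply: continuousN; exact: cH.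
- move=> r x r1 xr; have [h1 h2] := hM r x r1 xr.
  by rewrite /= -opprD !normrN.
- by move=> t x; rewrite /= homH mulrN.
rewrite !funrposN in hA' intn Pn.
have qp r : 1 <= r ->
    (\int[omega]_x (cutoff r x)%:E)%E = (pairing h^\+ r)%:E /\
    (\int[omega]_x (cutoff r x)%:E)%E = (pairing h^\- r)%:E.
  move=> r1; have r0 : 0 < r by exact: lt_le_trans r1.
  have [hp hn] := hom _ (test_function_cutoff r0).
  split; [rewrite hp|rewrite hn]; rewrite integral_gt0_domain// fineK//;
    apply: integrable_fin_num => //.
  - by have [] := hA r r1.
  - by have [] := hA' r r1.
(* The pairings of h^+ and h^- are the same integral against [omega], so their growth coefficients
   agree. *)
have PpPn : pairing H^\+ 1 = pairing H^\- 1.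
  apply: (@growth_coefficient_unique _ (pairing h^\+) _ _ A A' e) => r r1.
    by have [] := hA r r1.
  have [p1 p2] := qp r r1; have [_] := hA' r r1.
  by have -> : pairing h^\- r = pairing h^\+ r by apply: EFin_inj; rewrite -p1 -p2.
exists A, (pairing H^\+ 1); split; last first.
  move=> r r1; have [hp _] := qp r r1; exists (pairing h^\+ r) => //.
  by have [] := hA r r1.
(* Either part of [H] could vanish as far as the hypotheses on [H] alone tell, so positivity is
   proved for the sum, which involves |H|. *)
have : 0 < pairing H^\+ 1 + pairing H^\- 1; last by rewrite PpPn; lra.
rewrite Pp Pn -mulrDr mulr_gt0//.
rewrite -(RintegralD measurableT intp intn) -lte_fin.
rewrite (_ : (\int[lam]_x _)%:E =
  (\int[lam]_x (`|H x| * flat_exp 2 (4 - sqnorm x))%:E)%E).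
  exact: integral_norm_homog_gt0 homH.
rewrite /Rintegral fineK; last first.
  by apply: integrable_fin_num => //; exact: (integrableD measurableT intp intn).
apply: eq_integral => x _; rewrite -mulrDl; congr ((_ * _)%:E).
by have := funrposDneg H => /(congr1 (@^~ x)).
Qed.

End harmonic_measure_growth.

Unset Implicit Arguments.

Theorem theorem4p4 (R : realType) (n d : nat) (n_ge2 : (2 <= n)%N)
    (d_ge1 : (1 <= d)%N) :
  exists C : R, 1 < C /\
    forall tau : R, 1 < tau ->
    forall h : 'rV[R]_n -> R,
      polynomial_of_degree d h -> harmonic_function h -> h 0 = 0 ->
    forall omega : {measure set 'rV[R]_n -> \bar R},
      harmonic_measure h omega ->
    let ratio (r : R) :=
      (omega (euclidean_cball (tau * r)) / omega (euclidean_cball r))%E in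
    [/\ ((tau ^+ (n + d - 2) / C)%:E <= limf_einf ratio (pinfty_nbhs R))%E,
        (limf_einf ratio (pinfty_nbhs R) <= limf_esup ratio (pinfty_nbhs R))%E
      & (limf_esup ratio (pinfty_nbhs R) <= (C * tau ^+ (n + d - 2))%:E)%E].
Proof.
case: d d_ge1 => // k _; set e := (n + k.+1 - 2)%N.
have en : e.+2 = (n + k.+1)%N by rewrite /e; lia.
have c0 : 0 < flat_exp 0 3 :> R by exact: flat_exp_gt0.
(* This depends on n and d only through [e], and exceeds 1 because [flat_exp 0 3] is exp(-1/3) <
   1. *)
exists (2 ^+ e.+1 / flat_exp 0 3); split.
  rewrite ltr_pdivlMr// mul1r; apply: (@lt_le_trans _ _ 1).
    by rewrite /flat_exp ltr0n expr0 mul1r expR_lt1 oppr_lt0 invr_gt0.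
  by apply: exprn_ege1; rewrite ler1n.
move=> tau tau1 h /polynomial_of_degreeE[H [ch cH homH Hn0 [M M0 hM]]] _ _.
move=> omega hom.
have hM' r (x : 'rV[R]_n) : 1 <= r -> cube 0 r x ->
    `|h x - H x| <= M * r ^+ k /\ `|H x| <= M * r ^+ k.+1.
  by move=> r1 xr; apply: hM => // i; have := xr i; rewrite mxE sub0r normrN.
have [A [P [P0 hq]]] := cutoff_integral_growth M0 en ch cH Hn0 hM' homH hom.
pose m (r : R) := fine (omega (euclidean_cball r)).
pose q (r : R) := fine (\int[omega]_x (cutoff r x)%:E)%E.
have [radon_omega _ _] := hom.
have mE (r : R) : 0 < r -> omega (euclidean_cball r) = (m r)%:E.
  move=> r0; rewrite fineK// ge0_fin_numE//; apply: radon_omega.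
  by apply: compact_euclidean_cball; exact: ltW.
have mq r : 0 < r -> flat_exp 0 3 * m r <= q r <= m (2 * r).
  move=> r0; have r20 : 0 < 2 * r by rewrite mulr_gt0.
  have /andP[] := cutoff_integral_bounds omega r0; rewrite !mE// => lo hi.
  have qE : (\int[omega]_x (cutoff r x)%:E)%E = (q r)%:E.
    rewrite fineK// fin_real// (le_lt_trans hi) ?ltry// andbT.
    by apply: lt_le_trans lo; rewrite -EFinM ltNyr.
  by move: lo hi; rewrite qE -EFinM !lee_fin => -> ->.
(* Beyond [r1] the relative error A/r is at most P/3, which produces the factors 2/3 and 4/3. The
   threshold varies with h, but only large radii matter for the limits. *)
pose r1 := 1 + 3 * `|A| / P.
have r1_ge1 : 1 <= r1 by rewrite lerDl divr_ge0 ?mulr_ge0// ltW.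
have qP r : r1 <= r -> 0 < r ->
    2 / 3 * P * r ^+ e <= q r <= 4 / 3 * P * r ^+ e.
  move=> r1r r0; have [s qs] := hq r (le_trans r1_ge1 r1r).
  have re0 : 0 < r ^+ e by rewrite exprn_gt0.
  have : A * (r ^+ e / r) <= r ^+ e * (P / 3).
    rewrite mulrCA ler_pM2l// ler_pdivrMr//.
    have : r1 * P <= r * P by rewrite ler_pM2r.
    rewrite /r1 mulrDl mul1r divfK ?gt_eqF//; have := ler_norm A; lra.
  by rewrite /q qs/= ler_norml => bnd /andP[lo hi]; apply/andP; split; nra.
have dr := doubling_ratio c0 P0 mq qP tau1.
have r20 : 0 < 2 * r1 by lra.
have near_ratio (Q : set R) : (forall r, 0 < r -> 2 * r1 <= r -> Q r) ->
    pinfty_nbhs R Q.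
  move=> hQ; apply: (@filterS _ _ _ [set r | 2 * r1 <= r]).
    by move=> r /= r1r; apply: hQ => //; exact: lt_le_trans r1r.
  by apply: nbhs_pinfty_ge; rewrite num_real.
(* Positivity of [m r] is essential here: only then is the extended inverse the inverse of a real
   number. *)
have ratioE r : 0 < r -> 2 * r1 <= r ->
    (omega (euclidean_cball (tau * r)) / omega (euclidean_cball r))%E =
    (m (tau * r) / m r)%:E.
  move=> r0 r1r; have [m0 _] := dr r r0 r1r.
  have tr0 : 0 < tau * r by rewrite mulr_gt0// (lt_trans ltr01).
  by rewrite (mE _ tr0) (mE _ r0) inver gt_eqF.
split.
- apply: limf_einf_ge; apply: near_ratio => r r0 r1r /=.
  by rewrite ratioE// lee_fin; have [_ /andP[]] := dr r r0 r1r.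
- exact: limf_einf_le_esup.
- apply: limf_esup_le; apply: near_ratio => r r0 r1r /=.
  by rewrite ratioE// lee_fin; have [_ /andP[]] := dr r r0 r1r.
Qed.
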